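(* Let $A=T(R,\sigma,v)$ be a generalized Weyl algebra whose data satisfy condition $(\ast)$. The functor which forgets the grading defines an equivalence between $\mathcal{O}^+_Z$ and $\mathcal{O}$. Moreover, $$\mathcal{O}^+\cong\bigoplus_{w\in\pi_0(Z)/\Xi}\ \bigoplus_{n\in\mathbf{Z}}\mathcal{O}^+_w[n].$$
   Context: **GWA.** $R$ is a finitely generated commutative $\mathbf{C}$-algebra, $\sigma$ a $\mathbf{C}$-algebra automorphism of $R$, $v\in R$. $A=T(R,\sigma,v)$ is the $\mathbf{C}$-algebra generated by $R$, $t_+$, $t_-$ subject to $r t_+=t_+\sigma(r)$, $\sigma(r)t_-=t_-r$, $t_-t_+=\sigma(v)$, $t_+t_-=v$ for $r\in R$; it is $\mathbf{Z}$-graded with $\deg t_\pm=\pm1$ and $\deg r=0$ for $r\in R$. Graded modules are $\mathbf{Z}$-graded left modules, with degree-preserving maps and shift $M[n]_i=M_{i+n}$. **Categories.** An $A$-module $M$ is locally nilpotent if for every $m\in M$, $t_-^nm=0$ for $n\gg0$. $\mathcal{O}^+$ is the category of graded locally nilpotent $A$-modules; $\mathcal{O}$ is the category of ungraded locally nilpotent $A$-modules. **Right $R$-structure and support.** Every graded $A$-module $M$ is an $(A,R)$-bimodule via $x\cdot r=\sigma^{-i}(r)x$ for $x\in M_i$, $r\in R$. $\operatorname{ann}(M)$ is the annihilator of $M$ as a right $R$-module and $\operatorname{supp}(M)=\{\mathfrak{p}\in\operatorname{Spec}R:\operatorname{ann}(M)\subset\mathfrak{p}\}$. If $W$ is a union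 of connected components of $\operatorname{supp}(M)$, the summand $M_W$ of $M$ supported on $W$ is $M\cdot 1_W$, where $1_W\in R/\operatorname{ann}(M)$ is the idempotent corresponding to the open-closed subset $W$. **Condition $(\ast)$.** Let $Z=\{\mathfrak{p}\in\operatorname{Spec}R:v\in\mathfrak{p}\}$, let $\pi_0(Z)$ be its set of connected components, and let $\Xi(\mathfrak{p})=\sigma^{-1}(\mathfrak{p})$ on $\operatorname{Spec}R$. $(\ast)$: for every connected component $W$ of $Z$ and every $n\in\mathbf{Z}$, $W\cap\Xi^n(Z)$ is either empty or a connected component of $Z$, and for $n\gg0$, $W\cap\Xi^n(Z)=\varnothing$. **The modules $P_W$.** For $n>0$ let $A(n)=A/At_-^n$; its support is contained in $\bigcup_{j=0}^{n-1}\Xi^j(Z)$. For $W\in\pi_0(Z)$, choose $N$ so large that $W\cap\Xi^n(Z)=\varnothing$ for all $n\ge N$, and let $P_W=A(N)_W$; under $(\ast)$ it is independent of such $N$ up to canonical isomorphism. **Blocks.** $\pi_0(Z)/\Xi$ is the set of equivalence classes in $\pi_0(Z)$ for: $W_1\sim W_2$ iff $W_2=\Xi^n(W_1)$ for some $n\in\mathbf{Z}$. For each $w\in\pi_0(Z)/\Xi$ fix $W_w\in w$, set $\chi_w=\{n\in\mathbf{Z}:\Xi^{-n}(W_w)\in\pi_0(Z)\}$, and for $n\in\chi_w$ set $P_{w,n}=P_{\Xi^{-n}(W_w)}[n]$. $\mathcal{O}^+_w$ is the thick subcategory of $\mathcal{O}^+$ generated by the modules $P_{w,n}$, $n\in\chi_w$,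 and $\mathcal{O}^+_Z$ is the thick subcategory of $\mathcal{O}^+$ generated by all the $\mathcal{O}^+_w$. Here the thick subcategory generated by a class of objects means the smallest full subcategory containing them and closed under isomorphisms, subobjects, quotients, extensions and arbitrary direct sums. **Direct sums of categories.** $\mathcal{O}^+_w[n]$ denotes the category of shifts $M[n]$ of objects $M$ of $\mathcal{O}^+_w$. For an abelian category $\mathcal{A}$, $\bigoplus_{\mathbf{Z}}\mathcal{A}[n]$ has as objects formal sums $\bigoplus_i a_i[n_i]$ of formal shifts of objects $a_i$ of $\mathcal{A}$, with $\operatorname{Hom}(\bigoplus_i a_i[n_i],\bigoplus_j b_j[m_j])=\prod_i\bigoplus_j\operatorname{Hom}(a_i[n_i],b_j[m_j])$, where $\operatorname{Hom}(a[n],b[m])=\operatorname{Hom}_{\mathcal{A}}(a,b)$ if $n=m$ and $0$ otherwise (one summand for each $n$). The double direct sum in the claim is formed in the same way, with no nonzero morphisms between summands with different index $(w,n)$; the equivalence is given by realizing formal sums as direct sums of modules. *)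

(* Defs.v *)
From HB Require Import structures.
From mathcomp Require Import all_boot all_order all_algebra.
From mathcomp Require Import all_classical all_reals topology.
From mathcomp Require Import generic_quotient.

Set Implicit Arguments.
Unset Strict Implicit.
Unset Printing Implicit Defensive.

Import GRing.Theory.
Local Open Scope classical_set_scope.
Local Open Scope ring_scope.
Local Open Scope quotient_scope.

Record category := Category {
  ob :> Type;
  mor : ob -> ob -> Type;
  idm : forall x, mor x x;
  compm : forall x y z, mor y z -> mor x y -> mor x z;
  compm1 : forall x y (f : mor x y), compm f (idm x) = f;
  comp1m : forall x y (f : mor x y), compm (idm y) f = f;
  compmA : forall x y z t (h : mor z t) (g : mor y z) (f : mor x y),
    compm h (compm g f) = compm (compm h g) f }.

Definition is_iso (C : category) (x y : C) (f : mor x y) : Prop :=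
  exists g : mor y x, compm g f = idm x /\ compm f g = idm y.

Definition isomorphic (C : category) (x y : C) : Prop :=
  exists f : mor x y, is_iso f.

Record functor (C D : category) := Functor {
  fob :> C -> D;
  fhom : forall x y, mor x y -> mor (fob x) (fob y);
  fhom1 : forall x, fhom (idm x) = idm (fob x);
  fhomM : forall x y z (g : mor y z) (f : mor x y),
    fhom (compm g f) = compm (fhom g) (fhom f) }.

Definition id_functor (C : category) : functor C C.
Proof. by exists (fun x => x) (fun x y f => f). Defined.

Definition comp_functor (C D E : category) (G : functor D E) (F : functor C D) :
  functor C E.
Proof.
exists (fun x => G (F x)) (fun x y f => fhom G (fhom F f)).
- by move=> x; rewrite !fhom1.
- by move=> x y z g f; rewrite !fhomM.
Defined.

Definition nat_isomorphic (C D : category) (F G : functor C D) : Prop :=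
  exists eta : forall x, mor (F x) (G x),
    (forall x y (f : mor x y),
       compm (fhom G f) (eta x) = compm (eta y) (fhom F f)) /\
    (forall x, is_iso (eta x)).

Definition is_equivalence (C D : category) (F : functor C D) : Prop :=
  exists G : functor D C,
    nat_isomorphic (comp_functor G F) (id_functor C) /\
    nat_isomorphic (comp_functor F G) (id_functor D).

Definition full_sub (C : category) (P : C -> Prop) : category.
Proof.
exists {x : C | P x} (fun x y => mor (sval x) (sval y))
  (fun x => idm (sval x)) (fun x y z g f => compm g f).
- by move=> x y f; rewrite compm1.
- by move=> x y f; rewrite comp1m.
- by move=> x y z t h g f; rewrite compmA.
Defined.

(** The direct sum of categories: a formal direct sum has one summand for each
    index, and there are no nonzero morphisms between summands with different
    indices, so that [\prod_i \bigoplus_j Hom(a_i, b_j)] is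
    [\prod_i Hom(a_i, b_i)]. *)
Definition sum_cat (J : Type) (C : J -> category) : category.
Proof.
exists (forall j, C j) (fun a b => forall j, mor (a j) (b j))
  (fun a j => idm (a j)) (fun a b c g f j => compm (g j) (f j)).
- by move=> a b f; apply: functional_extensionality_dep => j; rewrite compm1.
- by move=> a b f; apply: functional_extensionality_dep => j; rewrite comp1m.
- move=> a b c d h g f; apply: functional_extensionality_dep => j.
  by rewrite compmA.
Defined.

Record spec (R : comPzRingType) := Spec {
  spec_set :> set R;
  spec0 : spec_set 0;
  specD : forall x y, spec_set x -> spec_set y -> spec_set (x + y);
  specM : forall a x, spec_set x -> spec_set (a * x);
  spec1 : ~ spec_set 1;
  spec_prime : forall x y, spec_set (x * y) -> spec_set x \/ spec_set y }.

HB.instance Definition _ (R : comPzRingType) := gen_eqMixin (spec R).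
HB.instance Definition _ (R : comPzRingType) := gen_choiceMixin (spec R).

Definition zeros (R : comPzRingType) (S : set R) : set (spec R) :=
  [set p | S `<=` p].

Definition zopen (R : comPzRingType) : set_system (spec R) :=
  [set U | exists S : set R, U = ~` zeros S].

Lemma zopenT (R : comPzRingType) : @zopen R setT.
Proof.
exists setT; apply/seteqP; split => // p _ /= h.
exact: (@spec1 _ p (h 1 I)).
Qed.

Lemma zopenI (R : comPzRingType) : setI_closed (@zopen R).
Proof.
move=> _ _ [S ->] [T ->]; exists [set z | exists x y, [/\ S x, T y & z = x * y]].
rewrite -setCU; congr (~` _); apply/seteqP; split => p /=.
  case=> h _ [x [y [Sx Ty ->]]]; last exact/specM/h.
  by rewrite mulrC; apply/specM/h.
move=> h; apply: contrapT => /not_orP[/existsNP[x /not_implyP[Sx px]]].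
move=> /existsNP[y /not_implyP[Ty py]].
have : spec_set p (x * y) by apply: h; exists x, y.
by case/spec_prime.
Qed.

Lemma zopen_bigU (R : comPzRingType) (I : Type) (f : I -> set (spec R)) :
  (forall i, zopen (f i)) -> zopen (\bigcup_i f i).
Proof.
move=> /choice[S h]; exists (\bigcup_i S i); apply/seteqP; split => p /=.
  case=> i _; rewrite h => hp hS; apply: hp => x Sx.
  by apply: hS; exists i.
move=> hS; apply: contrapT => hp; apply: hS => x [i _ Sx].
apply: contrapT => px; apply: hp; exists i => //.
by rewrite h => /(_ x Sx).
Qed.

HB.instance Definition _ (R : comPzRingType) := isOpenTopological.Build (spec R)
  (@zopenT R) (@zopenI R) (@zopen_bigU R).

Definition pi0 (T : topologicalType) (Z : set T) : set (set T) :=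
  [set W | exists2 p, Z p & W = connected_component Z p].

Record ring_aut (R : comPzRingType) := RingAut {
  aut :> {rmorphism R -> R};
  autV : R -> R;
  autK : cancel aut autV;
  autVK : cancel autV aut }.

(** [autz s n] is [s ^ n]. *)
Definition autz (R : comPzRingType) (s : ring_aut R) (n : int) (r : R) : R :=
  match n with
  | Posz n => iter n s r
  | Negz n => iter n.+1 (autV s) r
  end.

Section AutTheory.
Variables (R : comPzRingType) (s : ring_aut R).

Lemma autV_sub : zmod_morphism (autV s).
Proof. by move=> x y; apply: (can_inj (autK s)); rewrite rmorphB /= !autVK. Qed.

Lemma autV_mul : monoid_morphism (autV s).
Proof.
split; first by rewrite -[1 in LHS](rmorph1 s) autK.
by move=> x y; apply: (can_inj (autK s)); rewrite rmorphM /= !autVK.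
Qed.

Lemma autz_sub n : zmod_morphism (autz s n).
Proof.
have p (f : R -> R) : zmod_morphism f -> forall k, zmod_morphism (iter k f).
  by move=> fB; elim=> [|k IH] x y //=; rewrite IH fB.
by case: n => n; apply: p; [exact: rmorphB | exact: autV_sub].
Qed.

Lemma autz_mul n : monoid_morphism (autz s n).
Proof.
have p (f : R -> R) : monoid_morphism f -> forall k, monoid_morphism (iter k f).
  move=> [f1 fM]; elim=> [|k [IH1 IHM]]; first by split.
  by split=> [|x y] /=; rewrite ?IH1 ?IHM ?f1 ?fM.
by case: n => n; apply: p; [split; [exact: rmorph1|exact: rmorphM]|exact: autV_mul].
Qed.

HB.instance Definition _ n :=
  GRing.isZmodMorphism.Build R R (autz s n) (autz_sub n).
HB.instance Definition _ n :=
  GRing.isMonoidMorphism.Build R R (autz s n) (autz_mul n).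

Lemma autzS n r : autz s (n + 1) r = s (autz s n r).
Proof.
case: n => [n|[|n]]; first by rewrite addrC.
  by rewrite /= autVK.
have -> : Negz n.+1 + 1 = Negz n by rewrite !NegzE -[n.+2]addn1 PoszD opprD addrNK.
by rewrite /= autVK.
Qed.

Lemma autzP n r : autz s (n - 1) r = autV s (autz s n r).
Proof. by apply: (can_inj (autK s)); rewrite -autzS subrK autVK. Qed.

Lemma autzD m n r : autz s (m + n) r = autz s m (autz s n r).
Proof.
elim/int_rect: m => [|m IH|m IH]; first by rewrite add0r.
  by rewrite intS [1 + _]addrC addrAC !autzS IH.
by rewrite intS opprD [-1 + _]addrC addrAC !autzP IH.
Qed.

(** [Xi n] is the n-th power of the map p |-> s^-1(p). *)
Definition Xi (n : int) (p : spec R) : spec R.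
Proof.
exists (autz s n @^-1` p) => /=.
- by rewrite rmorph0; exact: spec0.
- by move=> x y px py; rewrite rmorphD; exact: specD.
- by move=> a x px; rewrite rmorphM; exact: specM.
- by rewrite rmorph1; exact: spec1.
- by move=> x y; rewrite rmorphM; exact: spec_prime.
Defined.

Definition condition_star (v : R) : Prop :=
  let Z := zeros [set v] in
  forall W, pi0 Z W ->
    (forall n : int, W `&` Xi n @` Z = set0 \/ pi0 Z (W `&` Xi n @` Z)) /\
    (exists N : int, forall n : int, (N <= n)%R -> W `&` Xi n @` Z = set0).

End AutTheory.

Section GWA.
Variables (R : comPzRingType) (s : ring_aut R) (v : R).

Inductive gwa_term : Type :=
| GConst of R | GTp | GTm
| GAdd of gwa_term & gwa_term | GOpp of gwa_term | GMul of gwa_term & gwa_term.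

(** The congruence whose quotient is the ring generated by [R], t_+ and t_-
    subject to the relations of T(R, s, v). When [R] is a C-algebra and [s] is
    C-linear, the scalars are central in it, so it is also the C-algebra with
    this presentation. *)
Inductive gwa_eq : gwa_term -> gwa_term -> Prop :=
| GRefl a : gwa_eq a a
| GSym a b : gwa_eq a b -> gwa_eq b a
| GTrans a b c : gwa_eq a b -> gwa_eq b c -> gwa_eq a c
| GAddE a a' b b' : gwa_eq a a' -> gwa_eq b b' -> gwa_eq (GAdd a b) (GAdd a' b')
| GOppE a a' : gwa_eq a a' -> gwa_eq (GOpp a) (GOpp a')
| GMulE a a' b b' : gwa_eq a a' -> gwa_eq b b' -> gwa_eq (GMul a b) (GMul a' b')
| GAddA a b c : gwa_eq (GAdd a (GAdd b c)) (GAdd (GAdd a b) c)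
| GAddC a b : gwa_eq (GAdd a b) (GAdd b a)
| GAdd0 a : gwa_eq (GAdd (GConst 0) a) a
| GAddN a : gwa_eq (GAdd (GOpp a) a) (GConst 0)
| GMulA a b c : gwa_eq (GMul a (GMul b c)) (GMul (GMul a b) c)
| GMul1l a : gwa_eq (GMul (GConst 1) a) a
| GMul1r a : gwa_eq (GMul a (GConst 1)) a
| GMulDl a b c : gwa_eq (GMul (GAdd a b) c) (GAdd (GMul a c) (GMul b c))
| GMulDr a b c : gwa_eq (GMul a (GAdd b c)) (GAdd (GMul a b) (GMul a c))
| GConstD r r' : gwa_eq (GConst (r + r')) (GAdd (GConst r) (GConst r'))
| GConstM r r' : gwa_eq (GConst (r * r')) (GMul (GConst r) (GConst r'))
| GRelp r : gwa_eq (GMul (GConst r) GTp) (GMul GTp (GConst (s r)))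
| GRelm r : gwa_eq (GMul (GConst (s r)) GTm) (GMul GTm (GConst r))
| GRelmp : gwa_eq (GMul GTm GTp) (GConst (s v))
| GRelpm : gwa_eq (GMul GTp GTm) (GConst v).

HB.instance Definition _ := gen_eqMixin gwa_term.
HB.instance Definition _ := gen_choiceMixin gwa_term.

Definition gwa_rel (a b : gwa_term) : bool := `[< gwa_eq a b >].

Lemma gwa_rel_refl : reflexive gwa_rel.
Proof. by move=> a; apply/asboolP/GRefl. Qed.

Lemma gwa_rel_sym : ssrbool.symmetric gwa_rel.
Proof. by move=> a b; apply/asboolP/asboolP => /GSym. Qed.

Lemma gwa_rel_trans : ssrbool.transitive gwa_rel.
Proof.
by move=> b a c /asboolP ab /asboolP bc; apply/asboolP/(GTrans ab bc).
Qed.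

Canonical gwa_equiv := EquivRel gwa_rel gwa_rel_refl gwa_rel_sym gwa_rel_trans.

(** [gwa] is T(R, s, v). *)
Definition gwa : Type := {eq_quot gwa_equiv}.
HB.instance Definition _ := Choice.on gwa.
HB.instance Definition _ := EqQuotient.on gwa.

Local Notation cl := (\pi_gwa).

Lemma gwaP a b : gwa_eq a b <-> cl a = cl b.
Proof.
split=> [/asboolP ab|ab]; first exact/eqmodP.
by apply/asboolP; apply/(@eqmodP _ gwa_equiv).
Qed.

Lemma gwa_repr a : gwa_eq (repr (cl a)) a.
Proof. by apply/gwaP; rewrite reprK. Qed.

Definition gwa_add (a b : gwa) : gwa := cl (GAdd (repr a) (repr b)).
Definition gwa_opp (a : gwa) : gwa := cl (GOpp (repr a)).
Definition gwa_mul (a b : gwa) : gwa := cl (GMul (repr a) (repr b)).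

Lemma gwa_addE a b : gwa_add (cl a) (cl b) = cl (GAdd a b).
Proof. by apply/gwaP/GAddE; exact: gwa_repr. Qed.
Lemma gwa_oppE a : gwa_opp (cl a) = cl (GOpp a).
Proof. by apply/gwaP/GOppE; exact: gwa_repr. Qed.
Lemma gwa_mulE a b : gwa_mul (cl a) (cl b) = cl (GMul a b).
Proof. by apply/gwaP/GMulE; exact: gwa_repr. Qed.

Lemma gwa_addA : associative gwa_add.
Proof.
elim/quotW=> a; elim/quotW=> b; elim/quotW=> c.
by rewrite (gwa_addE a b) (gwa_addE b c) !gwa_addE; exact/gwaP/GAddA.
Qed.
Lemma gwa_addC : commutative gwa_add.
Proof. by elim/quotW=> a; elim/quotW=> b; rewrite !gwa_addE; exact/gwaP/GAddC. Qed.
Lemma gwa_add0 : left_id (cl (GConst 0)) gwa_add.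
Proof. by elim/quotW=> a; rewrite !gwa_addE; exact/gwaP/GAdd0. Qed.
Lemma gwa_addN : left_inverse (cl (GConst 0)) gwa_opp gwa_add.
Proof. by elim/quotW=> a; rewrite (gwa_oppE a) !gwa_addE; exact/gwaP/GAddN. Qed.
Lemma gwa_mulA : associative gwa_mul.
Proof.
elim/quotW=> a; elim/quotW=> b; elim/quotW=> c.
by rewrite (gwa_mulE a b) (gwa_mulE b c) !gwa_mulE; exact/gwaP/GMulA.
Qed.
Lemma gwa_mul1l : left_id (cl (GConst 1)) gwa_mul.
Proof. by elim/quotW=> a; rewrite !gwa_mulE; exact/gwaP/GMul1l. Qed.
Lemma gwa_mul1r : right_id (cl (GConst 1)) gwa_mul.
Proof. by elim/quotW=> a; rewrite !gwa_mulE; exact/gwaP/GMul1r. Qed.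
Lemma gwa_mulDl : left_distributive gwa_mul gwa_add.
Proof.
elim/quotW=> a; elim/quotW=> b; elim/quotW=> c.
rewrite (gwa_addE a b) (gwa_mulE a c) (gwa_mulE b c) gwa_mulE gwa_addE.
exact/gwaP/GMulDl.
Qed.
Lemma gwa_mulDr : right_distributive gwa_mul gwa_add.
Proof.
elim/quotW=> a; elim/quotW=> b; elim/quotW=> c.
rewrite (gwa_addE b c) (gwa_mulE a b) (gwa_mulE a c) gwa_mulE gwa_addE.
exact/gwaP/GMulDr.
Qed.

HB.instance Definition _ :=
  GRing.isZmodule.Build gwa gwa_addA gwa_addC gwa_add0 gwa_addN.
HB.instance Definition _ := GRing.Zmodule_isPzRing.Build gwa
  gwa_mulA gwa_mul1l gwa_mul1r gwa_mulDl gwa_mulDr.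

Definition gR (r : R) : gwa := cl (GConst r).
Definition tp : gwa := cl GTp.
Definition tm : gwa := cl GTm.

Lemma gRD r r' : gR (r + r') = gR r + gR r'.
Proof. by rewrite [RHS]gwa_addE; exact/gwaP/GConstD. Qed.
Lemma gR_sub : zmod_morphism gR.
Proof. by move=> x y; apply: (addIr (gR y)); rewrite -gRD !subrK. Qed.
Lemma gR_mul : monoid_morphism gR.
Proof. by split=> // x y; rewrite [RHS]gwa_mulE; exact/gwaP/GConstM. Qed.
HB.instance Definition _ := GRing.isZmodMorphism.Build R gwa gR gR_sub.
HB.instance Definition _ := GRing.isMonoidMorphism.Build R gwa gR gR_mul.

Lemma gR_tp r : gR r * tp = tp * gR (s r).
Proof. by rewrite ![_ * _]gwa_mulE; exact/gwaP/GRelp. Qed.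
Lemma gR_tm r : gR (s r) * tm = tm * gR r.
Proof. by rewrite ![_ * _]gwa_mulE; exact/gwaP/GRelm. Qed.
Lemma tm_tp : tm * tp = gR (s v).
Proof. by rewrite ![_ * _]gwa_mulE; exact/gwaP/GRelmp. Qed.
Lemma tp_tm : tp * tm = gR v.
Proof. by rewrite ![_ * _]gwa_mulE; exact/gwaP/GRelpm. Qed.

Lemma gwa_ind (P : gwa -> Prop) :
  (forall r, P (gR r)) -> P tp -> P tm ->
  (forall a b, P a -> P b -> P (a + b)) -> (forall a, P a -> P (- a)) ->
  (forall a b, P a -> P b -> P (a * b)) -> forall a, P a.
Proof.
move=> PR Pp Pm PD PN PM; elim/quotW; elim => //.
- by move=> a Pa b Pb; rewrite -gwa_addE; exact: PD.
- by move=> a Pa; rewrite -gwa_oppE; exact: PN.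
- by move=> a Pa b Pb; rewrite -gwa_mulE; exact: PM.
Qed.

(** The homogeneous parts: the smallest additive subgroups which are closed
    under products and such that deg t_+ = 1, deg t_- = -1 and deg r = 0. *)
Inductive gdeg : int -> gwa -> Prop :=
| gdegR r : gdeg 0 (gR r)
| gdeg_tp : gdeg 1 tp
| gdeg_tm : gdeg (-1) tm
| gdeg0 i : gdeg i 0
| gdegD i a b : gdeg i a -> gdeg i b -> gdeg i (a + b)
| gdegN i a : gdeg i a -> gdeg i (- a)
| gdegM i j a b : gdeg i a -> gdeg j b -> gdeg (i + j) (a * b).

(** The sum of the homogeneous parts is direct: [gwa] acts on families
    [int -> gwa] with t_+ and t_- shifting the index. *)
Fixpoint gact (a : gwa_term) (f : int -> gwa) : int -> gwa :=
  match a with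
  | GConst r => fun k => gR r * f k
  | GTp => fun k => tp * f (k - 1)
  | GTm => fun k => tm * f (k + 1)
  | GAdd a b => fun k => gact a f k + gact b f k
  | GOpp a => fun k => - gact a f k
  | GMul a b => gact a (gact b f)
  end.

Lemma gact_ext a f g : f =1 g -> gact a f =1 gact a g.
Proof.
elim: a f g => //= [r|||a IHa b IHb|a IHa|a IHa b IHb] f g fg k; rewrite ?fg //.
- by rewrite (IHa _ _ fg) (IHb _ _ fg).
- by rewrite (IHa _ _ fg).
- by apply: IHa; exact: IHb.
Qed.

Lemma gactD a f g k :
  gact a (fun i => f i + g i) k = gact a f k + gact a g k.
Proof.
elim: a f g k => /= [r|||a IHa b IHb|a IHa|a IHa b IHb] f g k; rewrite ?mulrDr //.
- by rewrite IHa IHb addrACA.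
- by rewrite IHa opprD.
- by rewrite -IHa; apply: gact_ext => i; exact: IHb.
Qed.

Lemma gact_eq a b : gwa_eq a b -> forall f, gact a f =1 gact b f.
Proof.
elim=> {a b} /=.
- by [].
- by move=> a b _ IH f k; rewrite IH.
- by move=> a b c _ IH _ IH' f k; rewrite IH IH'.
- by move=> a a' b b' _ IH _ IH' f k; rewrite IH IH'.
- by move=> a a' _ IH f k; rewrite IH.
- move=> a a' b b' _ IH _ IH' f k; rewrite IH.
  by apply: gact_ext => i; exact: IH'.
- by move=> a b c f k; rewrite addrA.
- by move=> a b f k; rewrite addrC.
- by move=> a f k; rewrite rmorph0 mul0r add0r.
- by move=> a f k; rewrite rmorph0 mul0r addNr.
- by [].
- by move=> a f k; rewrite rmorph1 mul1r.
- by move=> a f k; apply: gact_ext => i; rewrite rmorph1 mul1r.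
- by [].
- by move=> a b c f k; rewrite -gactD.
- by move=> r r' f k; rewrite rmorphD mulrDl.
- by move=> r r' f k; rewrite rmorphM mulrA.
- by move=> r f k; rewrite !mulrA gR_tp.
- by move=> r f k; rewrite !mulrA gR_tm.
- by move=> f k; rewrite mulrA tm_tp addrK.
- by move=> f k; rewrite mulrA tp_tm subrK.
Qed.

Lemma gdeg_gact i a : gdeg i a ->
  forall f k, gact (repr a) f k = a * f (k - i).
Proof.
have repD (a' b' : gwa) f : gact (repr (a' + b')) f =1 gact (GAdd (repr a') (repr b')) f.
  by apply: gact_eq; exact: (gwa_repr (GAdd (repr a') (repr b'))).
have repN (a' : gwa) f : gact (repr (- a')) f =1 gact (GOpp (repr a')) f.
  by apply: gact_eq; exact: (gwa_repr (GOpp (repr a'))).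
have repM (a' b' : gwa) f : gact (repr (a' * b')) f =1 gact (GMul (repr a') (repr b')) f.
  by apply: gact_eq; exact: (gwa_repr (GMul (repr a') (repr b'))).
elim=> {i a}.
- by move=> r f k; rewrite (gact_eq (gwa_repr _)) subr0.
- by move=> f k; rewrite (gact_eq (gwa_repr _)).
- by move=> f k; rewrite (gact_eq (gwa_repr _)) opprK.
- move=> i f k; rewrite mul0r (_ : (0 : gwa) = gR 0) ?rmorph0 //.
  by rewrite (gact_eq (gwa_repr _)) /= rmorph0 mul0r.
- by move=> i a b _ IH _ IH' f k; rewrite repD /= IH IH' mulrDl.
- by move=> i a _ IH f k; rewrite repN /= IH mulNr.
- move=> i j a b _ IH _ IH' f k; rewrite repM /= IH IH' mulrA.
  by rewrite opprD addrA.
Qed.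

Lemma gdeg_uniq (I : seq int) (f : int -> gwa) : uniq I ->
  (forall i, gdeg i (f i)) -> \sum_(i <- I) f i = 0 ->
  forall i, i \in I -> f i = 0.
Proof.
move=> uI hf sf i iI; pose d (k : int) : gwa := if k == 0 then 1 else 0.
have e (J : seq int) : gact (repr (\sum_(j <- J) f j)) d i =
    \sum_(j <- J) (if j == i then f j else 0).
  elim: J => [|j J IH].
    by rewrite !big_nil (gdeg_gact (@gdeg0 0)) mul0r.
  rewrite !big_cons; rewrite (gact_eq (gwa_repr _)) /= IH; congr (_ + _).
  rewrite (gdeg_gact (hf j)) /d subr_eq0 eq_sym.
  by case: ifP; rewrite ?mulr1 ?mulr0.
have := e I; rewrite sf (gdeg_gact (@gdeg0 0)) mul0r.
rewrite -big_mkcond -big_filter filter_pred1_uniq // big_seq1.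
by move=> <-.
Qed.

Lemma gdeg_comm i a : gdeg i a ->
  forall r, a * gR (autz s i r) = gR r * a.
Proof.
elim=> {i a}.
- by move=> r r'; rewrite -!rmorphM mulrC.
- by move=> r; rewrite -gR_tp.
- by move=> r /=; rewrite -gR_tm autVK.
- by move=> i r; rewrite mul0r mulr0.
- by move=> i a b _ IH _ IH' r; rewrite mulrDl IH IH' mulrDr.
- by move=> i a _ IH r; rewrite mulNr IH mulrN.
- move=> i j a b _ IH _ IH' r.
  by rewrite addrC autzD -mulrA IH' mulrA IH mulrA.
Qed.

End GWA.

Section Graded.
Variables (R : comPzRingType) (s : ring_aut R) (v : R).
Notation A := (gwa s v).

Record grading (M : lmodType A) := Grading {
  gr_deg :> int -> set M;
  gr0 : forall i, gr_deg i 0;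
  grB : forall i x y, gr_deg i x -> gr_deg i y -> gr_deg i (x - y);
  grZ : forall i j a x, gdeg i a -> gr_deg j x -> gr_deg (i + j) (a *: x);
  gr_span : forall x, exists (I : seq int) (f : int -> M),
    [/\ uniq I, forall i, gr_deg i (f i) & x = \sum_(i <- I) f i];
  gr_free : forall (I : seq int) (f : int -> M), uniq I ->
    (forall i, gr_deg i (f i)) -> \sum_(i <- I) f i = 0 ->
    forall i, i \in I -> f i = 0 }.

Record grmod := GrMod {
  gr_mod :> lmodType A;
  deg : grading gr_mod }.

Section Components.
Variable M : grmod.
Implicit Types (x y : M) (i : int).

Lemma deg0 i : deg M i 0. Proof. exact: gr0. Qed.
Definition hdec x : seq int * (int -> M) :=
  let h := cid (gr_span (deg M) x) in (sval h, sval (cid (svalP h))).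
Definition hsupp x : seq int := (hdec x).1.
Definition hcomp x i : M := if i \in hsupp x then (hdec x).2 i else 0.

Lemma hdecP x : [/\ uniq (hsupp x), forall i, deg M i ((hdec x).2 i)
  & x = \sum_(i <- hsupp x) (hdec x).2 i].
Proof. by rewrite /hsupp /hdec /=; case: cid => I /= hI; case: cid. Qed.

Lemma hsupp_uniq x : uniq (hsupp x). Proof. by case: (hdecP x). Qed.

Lemma hcomp_deg x i : deg M i (hcomp x i).
Proof. by rewrite /hcomp; case: ifP => _; [case: (hdecP x)|exact: deg0]. Qed.

Lemma big_restrict (I J : seq int) (f : int -> M) : uniq I -> uniq J ->
  {subset I <= J} ->
  \sum_(i <- J) (if i \in I then f i else 0) = \sum_(i <- I) f i.
Proof.
move=> uI uJ IJ; rewrite -big_mkcond -big_filter; apply: perm_big.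
apply: uniq_perm; rewrite ?filter_uniq // => i; rewrite mem_filter.
by case iI : (i \in I) => //=; exact: IJ.
Qed.

Lemma hcomp_sum x (I : seq int) : uniq I -> {subset hsupp x <= I} ->
  x = \sum_(i <- I) hcomp x i.
Proof.
move=> uI sI; case: (hdecP x) => u _ {1}->.
by rewrite -(big_restrict _ u uI sI).
Qed.

Lemma hcomp_uniq x (I : seq int) (f : int -> M) : uniq I ->
  (forall i, deg M i (f i)) -> x = \sum_(i <- I) f i ->
  forall i, hcomp x i = if i \in I then f i else 0.
Proof.
move=> uI hf xf.
pose J := undup (I ++ hsupp x).
have uJ : uniq J by exact: undup_uniq.
have IJ : {subset I <= J} by move=> j jI; rewrite mem_undup mem_cat jI.
have sJ : {subset hsupp x <= J}.
  by move=> j jI; rewrite mem_undup mem_cat jI orbT.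
pose g j := (if j \in I then f j else 0) - hcomp x j.
have hg j : deg M j (g j).
  by apply: grB; [case: ifP => // _; exact: deg0|exact: hcomp_deg].
have sg : \sum_(j <- J) g j = 0.
  by rewrite sumrB -(hcomp_sum uJ sJ) (big_restrict _ uI uJ IJ) -xf subrr.
move=> i; case iJ : (i \in J).
  by apply/eqP; rewrite eq_sym -subr_eq0; apply/eqP/(gr_free uJ hg sg).
have /negP h : i \notin hsupp x by apply: contraFN iJ; exact: sJ.
rewrite /hcomp; case: ifP => // _; case: ifP => // iI.
by rewrite (IJ _ iI) in iJ.
Qed.

Lemma hcomp0 i : hcomp (0 : M) i = 0.
Proof.
by rewrite (@hcomp_uniq 0 [::] (fun=> 0)) ?big_nil // => j; exact: deg0.
Qed.

End Components.

(** The right R-structure: [x . r = s^(-i)(r) x] for [x] of degree [i]. *)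
Definition ract (M : grmod) (x : M) (r : R) : M :=
  \sum_(i <- hsupp x) gR s v (autz s (- i) r) *: hcomp x i.

Lemma ractE (M : grmod) (x : M) r (I : seq int) (f : int -> M) : uniq I ->
  (forall i, deg M i (f i)) -> x = \sum_(i <- I) f i ->
  ract x r = \sum_(i <- I) gR s v (autz s (- i) r) *: f i.
Proof.
move=> uI hf xf; pose J := undup (I ++ hsupp x).
have uJ : uniq J by exact: undup_uniq.
have IJ : {subset I <= J} by move=> j jI; rewrite mem_undup mem_cat jI.
have sJ : {subset hsupp x <= J}.
  by move=> j jI; rewrite mem_undup mem_cat jI orbT.
rewrite /ract -(big_restrict _ (hsupp_uniq x) uJ sJ).
rewrite -(big_restrict _ uI uJ IJ); apply: eq_bigr => j _.
transitivity (gR s v (autz s (- j) r) *: hcomp x j).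
  by case: ifP => //; rewrite /hcomp => ->; rewrite scaler0.
by rewrite (hcomp_uniq uI hf xf); case: ifP => // _; rewrite scaler0.
Qed.

Lemma ract_sub (M : grmod) r : zmod_morphism (fun x : M => ract x r).
Proof.
move=> x y; pose J := undup (hsupp x ++ hsupp y).
have uJ : uniq J by exact: undup_uniq.
have xJ : {subset hsupp x <= J} by move=> j jI; rewrite mem_undup mem_cat jI.
have yJ : {subset hsupp y <= J}.
  by move=> j jI; rewrite mem_undup mem_cat jI orbT.
rewrite (ractE r uJ (hcomp_deg x) (hcomp_sum uJ xJ)).
rewrite (ractE r uJ (hcomp_deg y) (hcomp_sum uJ yJ)).
rewrite (@ractE _ (x - y) r J (fun i => hcomp x i - hcomp y i) uJ).
- by rewrite -sumrB; apply: eq_bigr => i _; rewrite scalerBr.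
- by move=> i; apply: grB; exact: hcomp_deg.
- by rewrite sumrB -(hcomp_sum uJ xJ) -(hcomp_sum uJ yJ).
Qed.

Lemma ract_hom (M : grmod) (x : M) i r : deg M i x ->
  ract x r = gR s v (autz s (- i) r) *: x.
Proof.
move=> hx; pose f j := if j == i then x else 0.
have hf j : deg M j (f j).
  by rewrite /f; case: eqP => [->//|_]; exact: deg0.
rewrite (ractE r _ hf (I := [:: i])) ?big_seq1 /f ?eqxx //.
Qed.

Lemma ract_sum (M : grmod) r (J : seq int) (f : int -> M) :
  ract (\sum_(j <- J) f j) r = \sum_(j <- J) ract (f j) r.
Proof.
have r0 : ract (0 : M) r = 0 by have := ract_sub r (0 : M) 0; rewrite !subrr.
have rD (x y : M) : ract (x + y) r = ract x r + ract y r.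
  rewrite -[y in LHS]opprK ract_sub -[- y]sub0r ract_sub r0 sub0r opprK //.
by elim: J => [|j J IH]; rewrite ?big_nil // !big_cons rD IH.
Qed.

Lemma ractZ (M : grmod) a (x : M) r : ract (a *: x) r = a *: ract x r.
Proof.
have r0 : ract (0 : M) r = 0 by have := ract_sub r (0 : M) 0; rewrite !subrr.
have rN (y : M) : ract (- y) r = - ract y r by rewrite -sub0r ract_sub r0 sub0r.
have rD (y z : M) : ract (y + z) r = ract y r + ract z r.
  by rewrite -[z in LHS]opprK ract_sub rN opprK.
suff key b k : gdeg k b -> forall y : M, ract (b *: y) r = b *: ract y r.
  elim/gwa_ind: a x => [r'|||a b IHa IHb|a IHa|a b IHa IHb] x.
  - exact/key/gdegR.
  - exact/key/gdeg_tp.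
  - exact/key/gdeg_tm.
  - by rewrite scalerDl rD IHa IHb scalerDl.
  - by rewrite scaleNr rN IHa scaleNr.
  - by rewrite -scalerA IHa IHb scalerA.
move=> hb y; rewrite {1}(hcomp_sum (hsupp_uniq y) (fun i h => h)) scaler_sumr.
rewrite ract_sum [in RHS]/ract scaler_sumr; apply: eq_bigr => i _.
rewrite (@ract_hom M _ (k + i) r (grZ hb (hcomp_deg y i))) !scalerA; congr (_ *: _).
rewrite -(gdeg_comm hb) -autzD; congr (_ * gR _ _ (autz _ _ _)).
by rewrite opprD addrA subrr sub0r.
Qed.

Definition rann (M : grmod) : set R := [set r | forall x : M, ract x r = 0].
Definition rsupp (M : grmod) : set (spec R) := zeros (rann M).

(** A lift to [R] of the idempotent 1_W of [R / rann M] (0 if there is none). *)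
Definition one_at (M : grmod) (W : set (spec R)) : R :=
  xget 0 [set e : R | rann M (e * e - e) /\
    forall p : spec R, rsupp M p -> (W p <-> ~ spec_set p e)].

Definition grshift (M : grmod) (n : int) : grmod.
Proof.
exists (gr_mod M), (fun i => deg M (i + n)).
- by move=> i; exact: gr0.
- by move=> i x y; exact: grB.
- by move=> i j a x ha hx; rewrite -addrA; exact: grZ.
- move=> x; exists [seq i - n | i <- hsupp x], (fun i => hcomp x (i + n)); split.
  + by rewrite map_inj_uniq ?hsupp_uniq //; exact: addIr.
  + by move=> i; exact: hcomp_deg.
  + rewrite big_map {1}(hcomp_sum (hsupp_uniq x) (fun i h => h)).
    by apply: eq_bigr => i _; rewrite subrK.
- move=> I f uI hf sf i iI.
  rewrite -[f i](congr1 f (addrK n i)).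
  apply: (@gr_free _ (deg M) [seq j + n | j <- I] (fun j => f (j - n))).
  + by rewrite map_inj_uniq //; exact: addIr.
  + by move=> j; have := hf (j - n); rewrite subrK.
  + by rewrite big_map -{2}sf; apply: eq_bigr => j _; rewrite addrK.
  + exact: map_f.
Defined.

Record grsub (M : grmod) := GrSub {
  sub_set :> pred M;
  sub_closed : submod_closed sub_set;
  sub_hcomp : forall x i, sub_set x -> sub_set (hcomp x i) }.

HB.instance Definition _ (M : grmod) (S : grsub M) :=
  GRing.isSubmodClosed.Build A M (sub_set S)
    (GRing.submod_closed_semi (sub_closed S)).

Record sub_type (M : grmod) (S : grsub M) := SubType {
  sub_val :> M; sub_valP : sub_val \in sub_set S }.

HB.instance Definition _ M S := [isSub for @sub_val M S].
HB.instance Definition _ M S := [Choice of @sub_type M S by <:].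
HB.instance Definition _ M S := [SubChoice_isSubLmodule of @sub_type M S by <:].

Definition grsubmod (M : grmod) (S : grsub M) : grmod.
Proof.
exists (sub_type S), (fun i => [set x | deg M i (sub_val x)]) => /=.
- by move=> i; exact: gr0.
- by move=> i x y; exact: grB.
- by move=> i j a x; exact: grZ.
- move=> x; exists (hsupp (sub_val x)).
  exists (fun i => SubType (sub_hcomp i (sub_valP x))); split.
  + exact: hsupp_uniq.
  + by move=> i /=; exact: hcomp_deg.
  + apply: val_inj; rewrite raddf_sum /=.
    exact: (hcomp_sum (hsupp_uniq _) (fun i h => h)).
- move=> I f uI hf sf i iI; apply: val_inj => /=.
  apply: (@gr_free _ (deg M) I (fun i => sub_val (f i))) => //.
  by have := congr1 val sf; rewrite raddf_sum.
Defined.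

Section Quotient.
Variables (M : grmod) (S : grsub M).

Definition quo_rel (x y : M) : bool := x - y \in sub_set S.

Lemma quo_refl : reflexive quo_rel.
Proof. by move=> x; rewrite /quo_rel subrr rpred0. Qed.
Lemma quo_sym : ssrbool.symmetric quo_rel.
Proof. by move=> x y; rewrite /quo_rel -opprB rpredN. Qed.
Lemma quo_trans : ssrbool.transitive quo_rel.
Proof.
by move=> y x z xy yz; rewrite /quo_rel -(subrK y x) -addrA rpredD.
Qed.

Canonical quo_equiv := EquivRel quo_rel quo_refl quo_sym quo_trans.

Definition quo : Type := {eq_quot quo_equiv}.
HB.instance Definition _ := Choice.on quo.
HB.instance Definition _ := EqQuotient.on quo.

Definition quo_pi (x : M) : quo := \pi_quo x.

Lemma quo_piP x y : quo_pi x = quo_pi y <-> x - y \in sub_set S.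
Proof.
by split=> h; [exact/(@eqmodP _ quo_equiv)|exact/eqmodP].
Qed.

Lemma quo_repr x : repr (quo_pi x) - x \in sub_set S.
Proof. by apply/quo_piP; rewrite /quo_pi reprK. Qed.

Lemma quo_ind (P : quo -> Prop) : (forall x, P (quo_pi x)) -> forall x, P x.
Proof. by move=> h x; rewrite -(reprK x); exact: h. Qed.

Definition quo_add (x y : quo) := quo_pi (repr x + repr y).
Definition quo_opp (x : quo) := quo_pi (- repr x).
Definition quo_scale (a : A) (x : quo) := quo_pi (a *: repr x).

Lemma quo_addE x y : quo_add (quo_pi x) (quo_pi y) = quo_pi (x + y).
Proof. by apply/quo_piP; rewrite opprD addrACA rpredD ?quo_repr. Qed.
Lemma quo_oppE x : quo_opp (quo_pi x) = quo_pi (- x).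
Proof. by apply/quo_piP; rewrite -opprD rpredN quo_repr. Qed.
Lemma quo_scaleE a x : quo_scale a (quo_pi x) = quo_pi (a *: x).
Proof. by apply/quo_piP; rewrite -scalerBr rpredZ ?quo_repr. Qed.

Lemma quo_addA : associative quo_add.
Proof.
elim/quo_ind=> x; elim/quo_ind=> y; elim/quo_ind=> z.
by rewrite (quo_addE x y) (quo_addE y z) !quo_addE addrA.
Qed.
Lemma quo_addC : commutative quo_add.
Proof. by elim/quo_ind=> x; elim/quo_ind=> y; rewrite !quo_addE addrC. Qed.
Lemma quo_add0 : left_id (quo_pi 0) quo_add.
Proof. by elim/quo_ind=> x; rewrite quo_addE add0r. Qed.
Lemma quo_addN : left_inverse (quo_pi 0) quo_opp quo_add.
Proof. by elim/quo_ind=> x; rewrite (quo_oppE x) quo_addE addNr. Qed.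

HB.instance Definition _ :=
  GRing.isZmodule.Build quo quo_addA quo_addC quo_add0 quo_addN.

Lemma quo_scaleA a b x : quo_scale a (quo_scale b x) = quo_scale (a * b) x.
Proof.
by elim/quo_ind: x => x; rewrite (quo_scaleE b x) !quo_scaleE scalerA.
Qed.
Lemma quo_scale1 : left_id 1 quo_scale.
Proof. by elim/quo_ind=> x; rewrite quo_scaleE scale1r. Qed.
Lemma quo_scaleDr : right_distributive quo_scale +%R.
Proof.
move=> a; elim/quo_ind=> x; elim/quo_ind=> y.
rewrite [quo_pi x + _]quo_addE !quo_scaleE [RHS]quo_addE.
by rewrite scalerDr.
Qed.
Lemma quo_scaleDl x : {morph quo_scale^~ x : a b / a + b}.
Proof.
by elim/quo_ind: x => x a b; rewrite !quo_scaleE [RHS]quo_addE scalerDl.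
Qed.

HB.instance Definition _ := GRing.Zmodule_isLmodule.Build A quo
  quo_scaleA quo_scale1 quo_scaleDr quo_scaleDl.

Lemma quo_piD x y : quo_pi (x + y) = quo_pi x + quo_pi y.
Proof. by rewrite [RHS]quo_addE. Qed.

Lemma quo_pi_sum (I : seq int) (f : int -> M) :
  \sum_(i <- I) quo_pi (f i) = quo_pi (\sum_(i <- I) f i).
Proof. by elim: I => [|i I IH]; rewrite ?big_nil // !big_cons quo_piD IH. Qed.

Definition grquo : grmod.
Proof.
exists quo, (fun i => [set quo_pi x | x in deg M i]).
- by move=> i; exists 0 => //; exact: gr0.
- move=> i _ _ [x hx <-] [y hy <-]; exists (x - y); first exact: grB.
  by rewrite quo_piD; congr (_ + _); rewrite [RHS]quo_oppE.
- move=> i j a _ ha [x hx <-]; exists (a *: x); first exact: grZ.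
  by rewrite [RHS]quo_scaleE.
- elim/quo_ind=> x; exists (hsupp x), (fun i => quo_pi (hcomp x i)); split.
  + exact: hsupp_uniq.
  + by move=> i; exists (hcomp x i) => //; exact: hcomp_deg.
  + by rewrite quo_pi_sum -(hcomp_sum (hsupp_uniq x) (fun i h => h)).
- move=> I f uI hf.
  have /choice[g hg] : forall i, exists x, deg M i x /\ quo_pi x = f i.
    by move=> i; case: (hf i) => x hx e; exists x.
  under eq_bigr do rewrite -(proj2 (hg _)).
  rewrite quo_pi_sum => /quo_piP; rewrite subr0 => gS i iI.
  rewrite -(proj2 (hg i)); apply/quo_piP; rewrite subr0.
  have := sub_hcomp i gS.
  by rewrite (hcomp_uniq uI (fun i => proj1 (hg i)) erefl) iI.
Defined.

End Quotient.

Lemma gwa_span (a : A) : exists (I : seq int) (f : int -> A),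
  [/\ uniq I, forall i, gdeg i (f i) & a = \sum_(i <- I) f i].
Proof.
suff [L hL ->] : exists2 L : seq (int * A),
    forall p, p \in L -> gdeg p.1 p.2 & a = \sum_(p <- L) p.2.
  exists (undup [seq p.1 | p <- L]), (fun i => \sum_(p <- L | p.1 == i) p.2).
  split; first exact: undup_uniq.
    move=> i; rewrite big_seq_cond; elim/big_ind: _ => [|x y|p].
    - exact: gdeg0.
    - exact: gdegD.
    - by case/andP=> /hL + /eqP <-.
  rewrite (exchange_big_dep xpredT) //= big_seq [RHS]big_seq.
  apply: eq_bigr => p pL; rewrite (eq_bigl (pred1 p.1)); last first.
    by move=> i; rewrite /= eq_sym.
  by rewrite -big_filter filter_pred1_uniq ?big_seq1 ?undup_uniq ?mem_undup ?map_f.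
elim/gwa_ind: a => [r|||a b [L hL ->] [L' hL' ->]|a [L hL ->]
  |a b [L hL ->] [L' hL' ->]].
- exists [:: (0, gR s v r)]; last by rewrite big_seq1.
  by move=> p; rewrite inE => /eqP ->; exact: gdegR.
- exists [:: (1, tp s v)]; last by rewrite big_seq1.
  by move=> p; rewrite inE => /eqP ->; exact: gdeg_tp.
- exists [:: (-1, tm s v)]; last by rewrite big_seq1.
  by move=> p; rewrite inE => /eqP ->; exact: gdeg_tm.
- exists (L ++ L'); last by rewrite big_cat.
  by move=> p; rewrite mem_cat => /orP[/hL|/hL'].
- exists [seq (p.1, - p.2) | p <- L]; last by rewrite big_map sumrN.
  by move=> _ /mapP[p /hL hp ->]; exact: gdegN.
- exists [seq (p.1 + q.1, p.2 * q.2) | p <- L, q <- L'].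
    by move=> _ /allpairsP[[p q] [/= /hL hp /hL' hq ->]]; exact: gdegM.
  by rewrite big_allpairs_dep mulr_suml; apply: eq_bigr => p _; rewrite mulr_sumr.
Qed.

Definition regmod : grmod.
Proof.
exists A^o, (@gdeg R s v).
- exact: gdeg0.
- by move=> i x y hx hy; apply: gdegD => //; exact: gdegN.
- by move=> i j a x; exact: gdegM.
- exact: gwa_span.
- exact: gdeg_uniq.
Defined.

(** The left ideal [A t_-^n], and [Acyc n] = A(n). *)
Definition tm_ideal_pred (n : nat) : pred regmod :=
  fun a => `[< exists b : A, a = b * tm s v ^+ n >].

Lemma tm_ideal_closed n : submod_closed (tm_ideal_pred n).
Proof.
split=> [|c _ _ /asboolP[a ->] /asboolP[b ->]]; apply/asboolP.
  by exists 0; rewrite mul0r.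
by exists (c * a + b); rewrite mulrDl -mulrA.
Qed.

Lemma gdeg_tmX n : gdeg (- n%:Z) (tm s v ^+ n).
Proof.
elim: n => [|n IH]; first exact: (gdegR _ _ 1).
by rewrite exprS intS opprD; exact: gdegM (gdeg_tm s v) IH.
Qed.

Lemma tm_ideal_hcomp n (a : regmod) i :
  tm_ideal_pred n a -> tm_ideal_pred n (hcomp a i).
Proof.
move=> /asboolP[b ab]; apply/asboolP.
have h : forall j, deg regmod j (hcomp (b : regmod) (j + n%:Z) * tm s v ^+ n).
  move=> j; rewrite -[X in deg _ X](addrK n%:Z).
  exact: (gdegM (hcomp_deg (b : regmod) (j + n%:Z)) (gdeg_tmX n)).
have e : a = \sum_(j <- [seq j - n%:Z | j <- hsupp (b : regmod)])
    hcomp (b : regmod) (j + n%:Z) * tm s v ^+ n.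
  rewrite big_map ab -mulr_suml; congr (_ * _).
  rewrite {1}(hcomp_sum (hsupp_uniq (b : regmod)) (fun i h => h)).
  by apply: eq_bigr => j _; rewrite subrK.
rewrite (hcomp_uniq _ h e); last first.
  by rewrite map_inj_uniq ?hsupp_uniq //; exact: addIr.
case: ifP => _; last by exists 0; rewrite mul0r.
by exists (hcomp (b : regmod) (i + n%:Z)).
Qed.

Definition tm_ideal (n : nat) : grsub regmod :=
  GrSub (tm_ideal_closed n) (@tm_ideal_hcomp n).

Definition Acyc (n : nat) : grmod := grquo (tm_ideal n).

(** [summand M W] is [M . 1_W]. *)
Definition summand_pred (M : grmod) (W : set (spec R)) : pred M :=
  fun x => `[< exists y : M, x = ract y (one_at M W) >].

Lemma summand_closed (M : grmod) W : submod_closed (@summand_pred M W).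
Proof.
split=> [|c _ _ /asboolP[x ->] /asboolP[y ->]]; apply/asboolP.
  by exists 0; have := ract_sub (one_at M W) (0 : M) 0; rewrite !subrr.
exists (c *: x + y); rewrite -ractZ.
apply: (addIr (- ract y (one_at M W))).
by rewrite -ract_sub !addrK.
Qed.

Lemma summand_hcomp (M : grmod) W (x : M) i :
  summand_pred W x -> summand_pred W (hcomp x i).
Proof.
move=> /asboolP[y ->]; apply/asboolP; set e := one_at M W.
have h : forall j, deg M j (gR s v (autz s (- j) e) *: hcomp y j).
  move=> j; rewrite -[X in deg _ X]add0r.
  by apply: grZ; [exact: gdegR|exact: hcomp_deg].
rewrite (hcomp_uniq (hsupp_uniq y) h erefl).
exists (hcomp y i); rewrite (ract_hom e (hcomp_deg y i)).
by case: ifP => // iy; rewrite [hcomp y i]/hcomp iy scaler0.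
Qed.

Definition summand (M : grmod) (W : set (spec R)) : grmod :=
  grsubmod (GrSub (@summand_closed M W) (@summand_hcomp M W)).

Section DirectSum.
Variables (I : Type) (M : I -> grmod).

Record dsum := DSum {
  dsum_fun :> forall i, M i;
  dsum_fin : finite_set [set i | dsum_fun i != 0] }.

HB.instance Definition _ := gen_eqMixin dsum.
HB.instance Definition _ := gen_choiceMixin dsum.

Lemma dsum_ext (x y : dsum) : (forall i, x i = y i) -> x = y.
Proof.
case: x => x hx; case: y => y hy /= xy.
have e : x = y by exact: functional_extensionality_dep.
by move: hy; rewrite -e => hy; congr DSum; exact: Prop_irrelevance.
Qed.

Lemma dsum_fin0 : finite_set [set i | (0 : M i) != 0].
Proof.
by apply: (sub_finite_set (B := set0)) => // i /=; rewrite eqxx.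
Qed.
Lemma dsum_finD (x y : dsum) : finite_set [set i | x i + y i != 0].
Proof.
apply: (sub_finite_set (B := [set i | x i != 0] `|` [set i | y i != 0])).
  move=> i /= h; case: (eqVneq (x i) 0) => [x0|]; last by left.
  by right; rewrite x0 add0r in h.
by rewrite finite_setU; split; exact: dsum_fin.
Qed.
Lemma dsum_fin_map (f : forall i, M i -> M i) (x : dsum) :
  (forall i, f i 0 = 0) -> finite_set [set i | f i (x i) != 0].
Proof.
move=> f0; apply: sub_finite_set (dsum_fin x) => i /=.
by apply: contra_neq => ->; exact: f0.
Qed.

Definition dsum0 := DSum dsum_fin0.
Definition dsum_add x y := DSum (dsum_finD x y).
Definition dsum_opp x :=
  DSum (@dsum_fin_map (fun i => -%R) x (fun i => oppr0 (M i))).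
Definition dsum_scale (a : A) x :=
  DSum (@dsum_fin_map (fun i => *:%R a) x (fun i => scaler0 (M i) a)).

Lemma dsum_addA : associative dsum_add.
Proof. by move=> x y z; apply: dsum_ext => i /=; rewrite addrA. Qed.
Lemma dsum_addC : commutative dsum_add.
Proof. by move=> x y; apply: dsum_ext => i /=; rewrite addrC. Qed.
Lemma dsum_add0 : left_id dsum0 dsum_add.
Proof. by move=> x; apply: dsum_ext => i /=; rewrite add0r. Qed.
Lemma dsum_addN : left_inverse dsum0 dsum_opp dsum_add.
Proof. by move=> x; apply: dsum_ext => i /=; rewrite addNr. Qed.
HB.instance Definition _ :=
  GRing.isZmodule.Build dsum dsum_addA dsum_addC dsum_add0 dsum_addN.

Lemma dsum_scaleA a b x : dsum_scale a (dsum_scale b x) = dsum_scale (a * b) x.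
Proof. by apply: dsum_ext => i /=; rewrite scalerA. Qed.
Lemma dsum_scale1 : left_id 1 dsum_scale.
Proof. by move=> x; apply: dsum_ext => i /=; rewrite scale1r. Qed.
Lemma dsum_scaleDr : right_distributive dsum_scale +%R.
Proof. by move=> a x y; apply: dsum_ext => i /=; rewrite scalerDr. Qed.
Lemma dsum_scaleDl x : {morph dsum_scale^~ x : a b / a + b}.
Proof. by move=> a b; apply: dsum_ext => i /=; rewrite scalerDl. Qed.
HB.instance Definition _ := GRing.Zmodule_isLmodule.Build A dsum
  dsum_scaleA dsum_scale1 dsum_scaleDr dsum_scaleDl.

Lemma dsum_sumE (J : seq int) (f : int -> dsum) i :
  (\sum_(j <- J) f j) i = \sum_(j <- J) f j i.
Proof. by elim: J => [|j J IH]; rewrite ?big_nil // !big_cons /= IH. Qed.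

Definition grdsum : grmod.
Proof.
exists dsum, (fun k => [set x : dsum | forall i, deg (M i) k (x i)]).
- by move=> k i; exact: gr0.
- by move=> k x y hx hy i; exact: grB.
- by move=> k l a x ha hx i; exact: grZ.
- move=> x; have /(@finite_seqP {classic I})[S hS] := dsum_fin x.
  pose J := undup (flatten [seq hsupp (x i) | i <- S]).
  have h k : finite_set [set i | hcomp (x i) k != 0].
    by apply: (@dsum_fin_map (fun i y => hcomp y k)) => i; exact: hcomp0.
  exists J, (fun k => DSum (h k)); split; first exact: undup_uniq.
    by move=> k i /=; exact: hcomp_deg.
  apply: dsum_ext => i; rewrite dsum_sumE /=.
  case: (eqVneq (x i) 0) => [->|xi].
    by rewrite big1 // => k _; exact: hcomp0.
  apply: hcomp_sum; first exact: undup_uniq.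
  move=> k hk; rewrite mem_undup; apply/flattenP; exists (hsupp (x i)) => //.
  have iS : (i : {classic I}) \in S by have : [set` S] i by rewrite -hS.
  exact: (map_f (fun i : {classic I} => hsupp (x i)) iS).
- move=> J f uJ hf sf k kJ; apply: dsum_ext => i.
  apply: (@gr_free _ (deg (M i)) J (fun k => f k i)) => //.
  + by move=> l; exact: hf.
  + by rewrite -dsum_sumE sf.
Defined.

End DirectSum.

Definition locally_nilpotent (M : lmodType A) : Prop :=
  forall m : M, exists N : nat, forall n : nat,
    (N <= n)%N -> tm s v ^+ n *: m = 0.

Lemma linear_ext (M N : lmodType A) (f g : {linear M -> N}) : f =1 g -> f = g.
Proof.
case: f => f [[fm] [fz]]; case: g => g [[gm] [gz]] /= fg.
move: fm fz; rewrite (functional_extensionality_dep fg) => fm fz.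
by rewrite (Prop_irrelevance fm gm) (Prop_irrelevance fz gz).
Qed.

Definition Mod : category.
Proof.
exists (lmodType A) (fun M N : lmodType A => {linear M -> N})
  (fun M : lmodType A => idfun : {linear M -> M})
  (fun (M N P : lmodType A) (g : {linear N -> P}) (f : {linear M -> N}) =>
    g \o f : {linear M -> P}).
- by move=> M N f; apply: linear_ext.
- by move=> M N f; apply: linear_ext.
- by move=> M N P Q h g f; exact: linear_ext.
Defined.

Record grhom (M N : grmod) := GrHom {
  gr_fun :> {linear M -> N};
  gr_fun_deg : forall i x, deg M i x -> deg N i (gr_fun x) }.

Lemma grhom_ext (M N : grmod) (f g : grhom M N) : f =1 g -> f = g.
Proof.
case: f => f fd; case: g => g gd /= /linear_ext e.
by move: fd; rewrite e => fd; rewrite (Prop_irrelevance fd gd).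
Qed.

Definition grid (M : grmod) : grhom M M.
Proof. by exists (idfun : {linear M -> M}). Defined.

Definition grcomp (M N P : grmod) (g : grhom N P) (f : grhom M N) : grhom M P.
Proof.
exists (gr_fun g \o gr_fun f : {linear M -> P}) => i x hx.
by do 2!apply: gr_fun_deg.
Defined.

Definition GrModCat : category.
Proof.
exists grmod grhom grid grcomp.
- by move=> M N f; exact: grhom_ext.
- by move=> M N f; exact: grhom_ext.
- by move=> M N P Q h g f; exact: grhom_ext.
Defined.

Definition Oplus : category :=
  @full_sub GrModCat (fun M => locally_nilpotent (M : grmod)).
Definition Ocat : category := @full_sub Mod locally_nilpotent.

Definition shiftO (M : Oplus) (n : int) : Oplus :=
  exist _ (grshift (sval M) n) (svalP M).

Lemma tm_absorb (a : A) (N : nat) :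
  exists (k : nat) (b : A), tm s v ^+ k * a = b * tm s v ^+ N.
Proof.
have comm r : tm s v ^+ N * gR s v r = gR s v (autz s N%:Z r) * tm s v ^+ N.
  by rewrite -(gdeg_comm (gdeg_tmX N)) -autzD addNr.
elim/gwa_ind: a N comm => [r|||a b IHa IHb|a IHa|a b IHa IHb] N comm.
- by exists N, (gR s v (autz s N%:Z r)).
- by exists N.+1, (gR s v (autz s N%:Z (s v))); rewrite exprSr -mulrA tm_tp comm.
- by exists N, (tm s v); rewrite -exprSr exprS.
- have [k [c hc]] := IHa N comm; have [l [d hd]] := IHb N comm.
  exists (k + l)%N, (tm s v ^+ l * c + tm s v ^+ k * d).
  rewrite mulrDr mulrDl [in X in X + _]addnC !exprD.
  by rewrite -!mulrA hc hd.
- by have [k [c hc]] := IHa N comm; exists k, (- c); rewrite mulrN hc mulNr.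
- have [l [d hd]] := IHb N comm.
  have [|k [c hc]] := IHa l.
    by move=> r; rewrite -(gdeg_comm (gdeg_tmX l)) -autzD addNr.
  by exists k, (c * d); rewrite mulrA hc -mulrA hd mulrA.
Qed.

Lemma Acyc_nilpotent n : locally_nilpotent (Acyc n).
Proof.
elim/quo_ind=> a; have [k [b e]] := tm_absorb a n; exists k => m km.
rewrite [LHS]quo_scaleE; apply/quo_piP; rewrite subr0.
by apply/asboolP; exists (tm s v ^+ (m - k) * b); rewrite -mulrA -e mulrA -exprD subnK.
Qed.

Definition AcycO (n : nat) : Oplus := exist _ (Acyc n) (@Acyc_nilpotent n).

Lemma summand_nilpotent (M : grmod) W :
  locally_nilpotent M -> locally_nilpotent (summand M W).
Proof.
move=> h x; have [N hN] := h (sub_val x); exists N => n Nn.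
by apply: val_inj => /=; exact: hN.
Qed.

Definition summandO (M : Oplus) (W : set (spec R)) : Oplus :=
  exist _ (summand (sval M) W) (@summand_nilpotent _ W (svalP M)).

Lemma dsum_nilpotent (I : Type) (M : I -> grmod) :
  (forall i, locally_nilpotent (M i)) -> locally_nilpotent (grdsum M).
Proof.
move=> h x; have /(@finite_seqP {classic I})[S hS] := dsum_fin x.
have [N hN] : exists N : nat, forall i : {classic I}, i \in S ->
    forall n, (N <= n)%N -> tm s v ^+ n *: (x i : M i) = 0.
  elim: S {hS} => [|i S [N hN]]; first by exists 0%N.
  have [N' hN'] := h i (x i); exists (maxn N N') => j.
  rewrite inE => /orP[/eqP ->|jS] n; rewrite geq_max => /andP[Nn Nn'].
    exact: hN'.
  exact: hN.
exists N => n Nn; apply: dsum_ext => i /=.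
case: (eqVneq (x i) 0) => [->|xi]; first exact: scaler0.
by apply: (hN i) => //; have : [set` S] i by rewrite -hS.
Qed.

Definition dsumO (I : Type) (M : I -> Oplus) : Oplus :=
  exist _ (grdsum (fun i => sval (M i)))
    (dsum_nilpotent (fun i => svalP (M i))).

Definition dsum_map (I : Type) (M N : I -> grmod)
  (f : forall i, grhom (M i) (N i)) (x : dsum M) : dsum N.
Proof.
exists (fun i => f i (x i)); apply: sub_finite_set (dsum_fin x) => i /=.
by apply: contra_neq => ->; exact: raddf0.
Defined.

Lemma dsum_map_linear (I : Type) (M N : I -> grmod)
  (f : forall i, grhom (M i) (N i)) : linear (dsum_map f).
Proof. by move=> a x y; apply: dsum_ext => i /=; rewrite linearP. Qed.

HB.instance Definition _ I M N f :=
  GRing.isLinear.Build A (dsum M) (dsum N) *:%R (@dsum_map I M N f)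
    (@dsum_map_linear I M N f).

Definition grdsum_map (I : Type) (M N : I -> grmod)
  (f : forall i, grhom (M i) (N i)) : grhom (grdsum M) (grdsum N).
Proof.
exists (dsum_map f : {linear grdsum M -> grdsum N}) => k x hx i /=.
exact: gr_fun_deg.
Defined.

Inductive thick (G : Oplus -> Prop) : Oplus -> Prop :=
| thick_gen M : G M -> thick G M
| thick_iso M N : isomorphic M N -> thick G M -> thick G N
| thick_sub M N (f : grhom (sval N) (sval M)) :
    injective f -> thick G M -> thick G N
| thick_quot M N (f : grhom (sval M) (sval N)) :
    set_surj setT setT f -> thick G M -> thick G N
| thick_ext M' M M'' (f : grhom (sval M') (sval M))
    (g : grhom (sval M) (sval M'')) :
    injective f -> set_surj setT setT g -> range f = [set x | g x = 0] ->
    thick G M' -> thick G M'' -> thick G M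
| thick_dsum (I : Type) (M : I -> Oplus) :
    (forall i, thick G (M i)) -> thick G (dsumO M).

Definition forget (Q : Oplus -> Prop) : functor (full_sub Q) Ocat.
Proof.
exists (fun M : full_sub Q =>
    exist locally_nilpotent (sval (sval M) : lmodType A) (svalP (sval M)))
  (fun M N (f : grhom (sval (sval M)) (sval (sval N))) => gr_fun f).
- by [].
- by [].
Defined.

Definition realize (J : Type) (Q : J -> Oplus -> Prop) :
  functor (sum_cat (fun j => full_sub (Q j))) Oplus.
Proof.
exists (fun a : sum_cat (fun j => full_sub (Q j)) => dsumO (fun j => sval (a j)))
  (fun a b f => grdsum_map f).
- by move=> a; apply: grhom_ext => x; apply: dsum_ext.
- by move=> a b c g f; apply: grhom_ext => x; apply: dsum_ext.
Defined.

Definition Zv : set (spec R) := zeros [set v].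

Definition block_of (W : set (spec R)) : set (set (spec R)) :=
  [set W' | pi0 Zv W' /\ exists n : int, W' = Xi s n @` W].

Definition blocks : set (set (set (spec R))) := block_of @` pi0 Zv.

(** [N W] is the integer chosen in the definition of P_W = A(N)_W, and [rep w]
    is the chosen representative W_w of the block [w]. *)
Variables (N : set (spec R) -> nat) (rep : {w | blocks w} -> set (spec R)).

Definition PW (W : set (spec R)) : Oplus := summandO (AcycO (N W)) W.

Definition chi (w : {w | blocks w}) : set int :=
  [set n | pi0 Zv (Xi s (- n) @` rep w)].

Definition Pwn (w : {w | blocks w}) (n : int) : Oplus :=
  shiftO (PW (Xi s (- n) @` rep w)) n.

Definition Ow (w : {w | blocks w}) : Oplus -> Prop :=
  thick (fun P => exists2 n, chi w n & P = Pwn w n).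

Definition OZ : Oplus -> Prop := thick (fun M => exists w, Ow w M).

(** O^+_w[n] *)
Definition Ow_shift (wn : {w | blocks w} * int) : Oplus -> Prop :=
  fun M => exists2 M0, Ow wn.1 M0 & M = shiftO M0 wn.2.

End Graded.

(** A commutative [C]-algebra is given by its structure morphism
    [iota : C -> R], since the library's [comAlgType C] excludes the zero ring;
    [subalg iota X] is the subalgebra generated by [X]. *)
Inductive subalg (C R : comPzRingType) (iota : C -> R) (X : seq R) : R -> Prop :=
| subalg_gen x : x \in X -> subalg iota X x
| subalg_const c : subalg iota X (iota c)
| subalgD x y : subalg iota X x -> subalg iota X y -> subalg iota X (x + y)
| subalgM x y : subalg iota X x -> subalg iota X y -> subalg iota X (x * y).

Definition fin_gen (C R : comPzRingType) (iota : C -> R) : Prop :=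
  exists X : seq R, forall r, subalg iota X r.

(* Main.v *)
Require Import Defs.
From mathcomp Require Import all_boot all_order all_algebra.
From mathcomp Require Import all_classical all_reals topology.
From mathcomp Require Import complex.
From HB Require Import structures.

Set Implicit Arguments.
Unset Strict Implicit.
Unset Printing Implicit Defensive.

Import Order.TTheory GRing.Theory Num.Theory.
Local Open Scope classical_set_scope.
Local Open Scope ring_scope.

(** Everything is read off the support of the underlying left R-module.
    For an element [x] of an A-module let [lsupp x] be the set of primes
    containing the ideal of all [r] with [r x = 0].  If [a] has degree [i] then
    [a sigma^i(r) = r a], so [lsupp (a x)] lies in the translate
    [Xi^i (lsupp x)]; and from [t_+ t_- = v] one gets, when [t_-^n x = 0], that
    [lsupp x] lies in the union of [Xi^j Z] for [0 <= j < n].  Condition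
    (star) implies that two translates of connected components of [Z] are either
    equal or disjoint, and that [Xi^n W = W] for a component [W] only if [n = 0].
    As [R] is Noetherian, [Z] has finitely many components, so the translates
    [Xi^n W_w] are closed, pairwise disjoint, indexed without repetition by
    pairs [(w, n)], and finitely many of them cover the support of any element
    of a locally nilpotent module.  An element whose support is covered by
    finitely many disjoint closed sets is the sum of elements supported on
    each of them, obtained by applying orthogonal idempotents of the quotient
    of [R] by the annihilator ([lsupp_decomposition]), and such a decomposition
    is unique because a nonzero element has nonempty support
    ([lsupp_independent]).

    In a graded module the right R-structure differs from the left one by the
    twist [sigma^(-i)] in degree [i]; hence a module is supported on [U] for
    the right structure exactly when [lsupp x] lies in [Xi^i U] for every [x]
    of degree [i].  This is the predicate [supported U].  It is stable under
    the operations generating a thick subcategory ([supported_thick]), and it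
    holds for [P_{w,n}] with [U = W_w].  Conversely a module supported on
    [W_w] is built from the [P_{w,n}] ([supported_in_Ow]): it is a quotient of
    the direct sum of its submodules generated by one homogeneous element [y],
    and those are handled by induction on the nilpotency order of [y], the
    case [t_- y = 0] giving a quotient of some [P_{w,n}].  Thus O^+_w consists
    of the modules supported on [W_w], its shift by [n] of those supported on
    [Xi^n W_w], and O^+_Z of those supported on the union of all [W_w].

    Both equivalences follow by checking that the functors are fully faithful
    and essentially surjective.  For the direct sum decomposition, a graded
    module is the direct sum of its parts supported on the sets [Xi^n W_w], and
    there are no nonzero maps between parts with different indices.  For the
    forgetful functor, let [U] be the union of the [W_w]: the sets [Xi^i U] are
    again disjoint and closed, so the elements with support in [Xi^i U] are the
    degree-[i] part of a grading on any ungraded locally nilpotent module, this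
    grading is the only one in O^+_Z, and every linear map respects it. *)

(** * Noetherian subrings and the basis theorem *)

Section Noetherian.
Variable R : comPzRingType.
Implicit Types (S I J : set R) (F : set (set R)) (x y z c : R).

Definition subring S : Prop :=
  [/\ S 0, S (-1), (forall x y, S x -> S y -> S (x + y))
    & forall x y, S x -> S y -> S (x * y)].

Definition ideal_in S I : Prop :=
  [/\ I `<=` S, I 0, (forall x y, I x -> I y -> I (x + y))
    & forall a x, S a -> I x -> I (a * x)].

(** The property is relative to a subset [S] of a fixed ring, so that adjoining
    generators one at a time stays inside [R] and needs no evaluation morphism
    from a polynomial ring; this also covers the zero ring. *)
Definition noetherian S : Prop :=
  forall F, F !=set0 -> F `<=` ideal_in S ->
    exists2 I, F I & forall J, F J -> I `<=` J -> J = I.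

Section Adjoin.
Variables (S : set R) (x : R).
Hypothesis Ssub : subring S.

(** The values at [x] of the polynomials of degree less than [n] with
    coefficients in [S].  The polynomial representing a value need not be
    unique. *)
Fixpoint adj_lt (n : nat) : set R :=
  if n is m.+1 then [set y | exists z c, [/\ adj_lt m z, S c & y = z + c * x ^+ m]]
  else [set 0].

Definition adjoin : set R := \bigcup_n adj_lt n.

Lemma adj_lt0 n : adj_lt n 0.
Proof.
have [S0 _ _ _] := Ssub.
by elim: n => [|n IH] //=; exists 0, 0; rewrite mul0r addr0.
Qed.

Lemma adj_ltD n y z : adj_lt n y -> adj_lt n z -> adj_lt n (y + z).
Proof.
have [_ _ SD _] := Ssub.
elim: n y z => [|n IH] y z /=; first by move=> -> ->; rewrite addr0.
move=> [y' [c [hy Sc ->]]] [z' [d [hz Sd ->]]].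
exists (y' + z'), (c + d); split; [exact: IH|exact: SD|].
by rewrite mulrDl addrACA.
Qed.

Lemma adj_ltZ n a y : S a -> adj_lt n y -> adj_lt n (a * y).
Proof.
have [_ _ _ SM] := Ssub => Sa.
elim: n y => [|n IH] y /=; first by move=> ->; rewrite mulr0.
move=> [z [c [hz Sc ->]]]; exists (a * z), (a * c).
by split; [exact: IH|exact: SM|rewrite mulrDr mulrA].
Qed.

Lemma adj_ltB n y z : adj_lt n y -> adj_lt n z -> adj_lt n (y - z).
Proof.
move=> hy hz; apply: adj_ltD => //; rewrite -mulN1r.
by apply: adj_ltZ => //; case: Ssub.
Qed.

Lemma adj_lt_mono m n : (m <= n)%N -> adj_lt m `<=` adj_lt n.
Proof.
move=> /subnK <-; elim: (n - m)%N => [|k IH] // y hy /=.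
exists y, 0; rewrite mul0r addr0; split=> //; first exact: IH.
by case: Ssub.
Qed.

Lemma adj_ltX n y : adj_lt n y -> adj_lt n.+1 (x * y).
Proof.
elim: n y => [|n IH] y; first by move=> ->; rewrite mulr0; exact: adj_lt0.
move=> [z [c [hz Sc ->]]]; exists (x * z), c; split=> //; first exact: IH.
by rewrite mulrDr exprS mulrCA.
Qed.

Lemma adj_lt1 c : S c -> adj_lt 1 c.
Proof. by move=> Sc; exists 0, c; rewrite mulr1 add0r. Qed.

Lemma subring1 : S 1.
Proof. by have [_ subring1' _ /(_ _ _ subring1' subring1')] := Ssub; rewrite mulrNN mulr1. Qed.

Lemma adjoin_sub : S `<=` adjoin.
Proof. by move=> c Sc; exists 1%N => //; exact: adj_lt1. Qed.

Lemma adjoin_gen : adjoin x.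
Proof. by exists 2%N => //; rewrite -[x]mulr1; apply/adj_ltX/adj_lt1/subring1. Qed.

Lemma adjoin_subring : subring adjoin.
Proof.
have [S0 SN SD SM] := Ssub.
have D y z : adjoin y -> adjoin z -> adjoin (y + z).
  move=> [m _ hy] [n _ hz]; exists (maxn m n) => //; apply: adj_ltD.
    by apply: adj_lt_mono hy; exact: leq_maxl.
  by apply: adj_lt_mono hz; exact: leq_maxr.
split=> //; try exact: adjoin_sub.
move=> y z [m _ hy] hz; elim: m y hy => [|m IH] y /=.
  by move=> ->; rewrite mul0r; exact: adjoin_sub.
move=> [y' [c [hy' Sc ->]]]; rewrite mulrDl; apply: D; first exact: IH.
case: hz => n _ hz; exists (m + n)%N => //; rewrite -mulrA; apply: adj_ltZ => //.
elim: m {IH hy'} => [|m IH]; first by rewrite mul1r.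
by rewrite exprS -mulrA; exact: adj_ltX.
Qed.

(** The possible coefficients of [x ^+ n] in expressions of degree at most [n]
    for elements of [I]. *)
Definition lead I (n : nat) : set R :=
  [set c | S c /\ exists2 z, adj_lt n z & I (z + c * x ^+ n)].

Lemma lead_ideal I n : ideal_in adjoin I -> ideal_in S (lead I n).
Proof.
have [S0 SN SD SM] := Ssub; move=> [Isub I0 ID IM]; split.
- by move=> c [].
- by split=> //; exists 0; [exact: adj_lt0|rewrite mul0r addr0].
- move=> c d [Sc [y hy Iy]] [Sd [z hz Iz]]; split; first exact: SD.
  exists (y + z); first exact: adj_ltD.
  by rewrite mulrDl addrACA; exact: ID.
- move=> a c Sa [Sc [y hy Iy]]; split; first exact: SM.
  exists (a * y); first exact: adj_ltZ.
  by rewrite -mulrA -mulrDr; apply: IM => //; exact: adjoin_sub.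
Qed.

Lemma lead_mono I m n : ideal_in adjoin I -> (m <= n)%N -> lead I m `<=` lead I n.
Proof.
move=> [Isub I0 ID IM] /subnK <-; elim: (n - m)%N => [|k IH] // c hc /=.
have [Sc [z hz Iz]] := IH c hc; split=> //; exists (x * z); first exact: adj_ltX.
rewrite addSn exprS mulrCA -mulrDr; apply: IM => //; exact: adjoin_gen.
Qed.

Lemma leadS I J n : I `<=` J -> lead I n `<=` lead J n.
Proof. by move=> IJ c [Sc [z hz /IJ Jz]]; split=> //; exists z. Qed.

(** An element of [J] can be changed by an element of [I] with the same leading
    coefficient, which lowers its degree. *)
Lemma lead_inj I J : ideal_in adjoin I -> ideal_in adjoin J -> I `<=` J ->
  (forall n, lead J n `<=` lead I n) -> J = I.
Proof.
move=> [Isub I0 ID IM] [Jsub J0 JD JM] IJ h; apply/seteqP; split=> // y Jy.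
have [n _ hn] := Jsub _ Jy; elim: n y hn Jy => [|n IH] y /=; first by move=> ->.
move=> [z [c [hz Sc ->]]] Jy.
have [|_ [z' hz' Iz']] := h n c; first by split=> //; exists z.
have -> : z + c * x ^+ n = (z - z') + (z' + c * x ^+ n) by rewrite addrA subrK.
apply: ID => //; apply: IH; first exact: adj_ltB.
have -> : z - z' = (z + c * x ^+ n) + -1 * (z' + c * x ^+ n).
  by rewrite mulN1r opprD addrACA subrr addr0.
apply: JD => //; apply: JM; last exact: IJ.
by apply: adjoin_sub; case: Ssub.
Qed.

(** The ideals [lead I n] increase with [n] and with [I], and determine [I]
    among the ideals comparable with it.  So choose [d] and [I1] with
    [lead I1 d] maximal among all the [lead I n]: this fixes [lead I n] for
    [n >= d] on the subfamily where [lead I d = lead I1 d].  It remains to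
    maximize the finitely many [lead I n] with [n < d], one after the other. *)
Lemma hilbert_basis : noetherian S -> noetherian adjoin.
Proof.
move=> noeS.
(* On a family where [lead I n] no longer grows with [I] for [n >= d], induction
   on [d] maximizes [lead I (d - 1)] first and then the lower ones. *)
have step d : forall F, F !=set0 -> F `<=` ideal_in adjoin ->
    (forall I J n, F I -> F J -> I `<=` J -> (d <= n)%N -> lead I n = lead J n) ->
    exists2 I, F I & forall J, F J -> I `<=` J -> J = I.
  elim: d => [|d IH] F [I0 FI0] Fid Fd.
    exists I0 => // J FJ IJ; apply: lead_inj => //; [exact: Fid|exact: Fid|].
    by move=> n; rewrite (Fd I0 J n).
  have [||_ [I1 FI1 <-] I1max] := noeS [set lead I d | I in F].
  - by exists (lead I0 d); exists I0.
  - by move=> _ [I /Fid FI <-]; exact: lead_ideal.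
  have [||I2 J2 n [F2 e2] [F3 e3] IJ|I2 [FI2 e2] I2max] :=
      IH [set I | F I /\ lead I d = lead I1 d].
  - by exists I1.
  - by move=> I2 [/Fid].
  - by rewrite leq_eqVlt => /orP[/eqP <-|dn]; [rewrite e2 e3|exact: Fd].
  exists I2 => // J FJ IJ; apply: I2max => //; split=> //; apply: I1max.
    by exists J.
  by rewrite -e2; exact: leadS.
move=> F [I0 FI0] Fid.
have [||_ [[d I1] FI1 <-] I1max] :=
    noeS [set lead p.2 p.1 | p in [set p : nat * set R | F p.2]].
- by exists (lead I0 0); exists (0%N, I0).
- by move=> _ [[n I] /= /Fid FI <-]; exact: lead_ideal.
rewrite /= in FI1 I1max.
have top J n : F J -> lead I1 d `<=` lead J d -> (d <= n)%N -> lead J n = lead I1 d.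
  move=> FJ h dn; apply: I1max; first by exists (n, J).
  by apply: (subset_trans h); apply: lead_mono => //; exact: Fid.
have [||I J n [FI eI] [FJ eJ] _ dn|I [FI eI] Imax] :=
    step d [set I | F I /\ lead I d = lead I1 d].
- by exists I1.
- by move=> I [/Fid].
- by rewrite (top I n) ?eI // (top J n) ?eJ.
exists I => // J FJ IJ; apply: Imax => //; split=> //; apply: top => //.
by rewrite -eI; exact: leadS.
Qed.

End Adjoin.

End Noetherian.

Section FinGen.
Variables (K : fieldType) (R : comPzRingType) (iota : {rmorphism K -> R}).

Lemma field_image_subring : subring (range iota).
Proof.
split.
- by exists 0; rewrite // rmorph0.
- by exists (-1); rewrite // rmorphN1.
- by move=> _ _ [x _ <-] [y _ <-]; exists (x + y); rewrite // rmorphD.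
- by move=> _ _ [x _ <-] [y _ <-]; exists (x * y); rewrite // rmorphM.
Qed.

Lemma field_image_noetherian : noetherian (range iota).
Proof.
move=> F [I0 FI0] Fid.
have [FT|FT] := pselect (F (range iota)).
  by exists (range iota) => // J /Fid[+ _ _ _] h; move=> ?; exact/seteqP.
exists I0 => // J FJ IJ; apply/seteqP; split=> // y Jy.
have [Jsub J0 JD JM] := Fid _ FJ; have [c _ cy] := Jsub _ Jy.
have [c0|c0] := eqVneq c 0.
  by rewrite -cy c0 rmorph0; case: (Fid _ FI0).
exfalso; apply: FT; suff <- : J = range iota by [].
apply/seteqP; split=> // _ [d _ <-].
have -> : iota d = iota (d / c) * y by rewrite -cy -rmorphM divfK.
by apply: JM => //; exists (d / c).
Qed.

Lemma fin_gen_noetherian : fin_gen iota -> noetherian [set: R].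
Proof.
move=> [X hX].
have [S [Ssub Snoe KS XS]] : exists S, [/\ subring S, noetherian S,
    range iota `<=` S & forall x, x \in X -> S x].
  elim: X {hX} => [|x X [S [Ssub Snoe KS XS]]].
    exists (range iota); split=> //; first exact: field_image_subring.
    exact: field_image_noetherian.
  exists (adjoin S x); split.
  - exact: adjoin_subring.
  - exact: hilbert_basis.
  - by apply: subset_trans KS _; exact: adjoin_sub.
  - move=> y; rewrite inE => /orP[/eqP ->|/XS Sy]; first exact: adjoin_gen.
    exact: adjoin_sub.
suff -> : [set: R] = S by [].
apply/seteqP; split=> // r _; elim: (hX r) => {r}.
- by move=> x /XS.
- by move=> c; apply: KS; exists c.
- by move=> x y _ Sx _ Sy; case: Ssub => _ _ + _; exact.
- by move=> x y _ Sx _ Sy; case: Ssub => _ _ _; exact.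
Qed.

End FinGen.

(** * Primes and idempotents *)

Section Spectrum.
Variable R : comPzRingType.
Hypothesis noeR : noetherian [set: R].
Implicit Types (I J S : set R) (a x y : R) (p q : spec R) (C U : set (spec R)).

Lemma spec_ext p q : (p : set R) = q -> p = q.
Proof.
case: p => I ? ? ? ? ?; case: q => J ? ? ? ? ? /= e; move: e => IJ.
by subst J; congr Spec; exact: Prop_irrelevance.
Qed.

Lemma specX p a k : spec_set p (a ^+ k) -> spec_set p a.
Proof.
elim: k => [|k IH]; first by move/(@spec1 _ p).
by rewrite exprS => /spec_prime[].
Qed.

(** An ideal which is maximal among those containing [J] and no power of [a] is
    prime: if it contained a product [x y] but neither factor, powers of [a]
    would lie in both enlarged ideals, and their product in the ideal. *)
Lemma prime_avoiding J a : ideal_in setT J -> (forall k, ~ J (a ^+ k)) ->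
  exists2 p, J `<=` spec_set p & ~ spec_set p a.
Proof.
move=> Jid Ja.
pose F := [set I | [/\ ideal_in setT I, J `<=` I & forall k, ~ I (a ^+ k)]].
have [||I [[_ I0 ID IM'] JI Ia] Imax] := noeR (F := F).
- by exists J; split.
- by move=> I [].
have IM c x : I x -> I (c * x) by exact: IM'.
have big x : ~ I x -> exists k c i, I i /\ a ^+ k = i + c * x.
  move=> Ix; apply: contrapT => hx; apply: Ix.
  pose I' := [set z | exists c i, I i /\ z = i + c * x].
  have II' : I `<=` I' by move=> z Iz; exists 0, z; rewrite mul0r addr0.
  have <- : I' = I.
    apply: Imax => //; split.
    - split=> //; first exact: II'.
      + move=> _ _ [c [i [Ii ->]]] [d [j [Ij ->]]]; exists (c + d), (i + j).
        by split; [exact: ID|rewrite mulrDl addrACA].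
      + move=> b _ _ [c [i [Ii ->]]]; exists (b * c), (b * i).
        by split; [exact: IM|rewrite mulrDr mulrA].
    - exact: subset_trans II'.
    - by move=> k [c [i [Ii e]]]; apply: hx; exists k, c, i.
  by exists 1, 0; rewrite mul1r add0r.
have I1 : ~ I 1 by exact: (Ia 0%N).
have Ipr x y : I (x * y) -> I x \/ I y.
  move=> Ixy; apply: contrapT => /not_orP[/big[k [c [i [Ii ek]]]]].
  move=> /big[l [d [j [Ij el]]]]; apply: (Ia (k + l)%N); rewrite exprD ek el.
  rewrite mulrDr; apply: (ID); first exact: IM.
  have -> : (i + c * x) * (d * y) = (d * y) * i + (c * d) * (x * y).
    by rewrite mulrDl [i * _]mulrC mulrACA.
  exact: (ID _ _ (IM _ _ Ii) (IM _ _ Ixy)).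
exists (@Spec R I I0 ID IM I1 Ipr) => //=.
exact: (Ia 1%N).
Qed.

(** The case [a = 1]. *)
Lemma ideal_unit J : ideal_in setT J -> zeros J = set0 -> J 1.
Proof.
move=> Jid J0; apply: contrapT => J1.
have [|p Jp _] := prime_avoiding (a := 1) Jid; first by move=> k; rewrite expr1n.
by have : zeros J p by []; rewrite J0.
Qed.

Lemma closed_zeros S : closed (zeros S).
Proof. by rewrite -openC; exists S. Qed.

Definition vanishing C : set R := [set r | forall p, C p -> spec_set p r].

Lemma zeros_vanishing C : closed C -> zeros (vanishing C) = C.
Proof.
rewrite -openC => -[S /(congr1 setC)]; rewrite !setCK => ->.
apply/seteqP; split=> p hp; last by move=> r; exact.
by move=> x Sx; apply: hp => q; exact.
Qed.

(** No prime contains the sum of the two vanishing ideals. *)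
Lemma comaximal_closed C1 C2 : closed C1 -> closed C2 -> C1 `&` C2 = set0 ->
  exists a b, [/\ vanishing C1 a, vanishing C2 b & a + b = 1].
Proof.
move=> cC1 cC2 C12.
suff [a [b [h1 h2 ->]]] : [set z | exists a b,
  [/\ vanishing C1 a, vanishing C2 b & z = a + b]] 1 by exists a, b.
have V0 C : vanishing C 0 by move=> p _; exact: spec0.
apply: ideal_unit.
  split=> //.
  - by exists 0, 0; rewrite addr0; split.
  - move=> _ _ [a [b [ha hb ->]]] [c [d [hc hd ->]]]; exists (a + c), (b + d).
    split; last by rewrite addrACA.
    + by move=> p Cp; apply: specD; [exact: ha|exact: hc].
    + by move=> p Cp; apply: specD; [exact: hb|exact: hd].
  - move=> c _ _ [a [b [ha hb ->]]]; exists (c * a), (c * b).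
    split; last by rewrite mulrDr.
    + by move=> p Cp; apply: specM; exact: ha.
    + by move=> p Cp; apply: specM; exact: hb.
apply/seteqP; split=> // p hp; rewrite -C12; split.
  rewrite -(zeros_vanishing cC1) => a ha; apply: hp.
  by exists a, 0; rewrite addr0.
rewrite -(zeros_vanishing cC2) => a ha; apply: hp.
by exists 0, a; rewrite add0r.
Qed.

(** If [a + b = 1] with [a] vanishing on [C1] and [b] on [C2], then [a b] lies in
    every prime containing [J], so that [(a b)^k] is in [J] for some [k].  The
    powers [a^k] and [b^k] are still comaximal, [x a^k + y b^k = 1], and
    [e = y b^k] is the idempotent modulo [J]. *)
Lemma split_idempotent J C1 C2 : ideal_in setT J -> closed C1 -> closed C2 ->
  C1 `&` C2 = set0 -> zeros J `<=` C1 `|` C2 ->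
  exists2 e, J (e * (1 - e)) &
    forall p, zeros J p -> (C1 p <-> ~ spec_set p e).
Proof.
move=> Jid cC1 cC2 C12 JC.
have [_ _ _ JM'] := Jid; have JM c x : J x -> J (c * x) by exact: JM'.
have [a [b [ha hb ab1]]] := comaximal_closed cC1 cC2 C12.
(* A positive exponent, so that [a ^+ k] still vanishes on [C1]. *)
have [k k0 Jk] : exists2 k, (0 < k)%N & J ((a * b) ^+ k).
  apply: contrapT => h; have [//|k Jk|p Jp] := @prime_avoiding J (a * b).
    by apply: h; exists k.+1; rewrite // exprS; exact: JM.
  apply; case: (JC p Jp) => Cp; last by apply: specM; exact: hb.
  by rewrite mulrC; apply: specM; exact: ha.
have [x [y e1]] : exists x y, 1 = x * a ^+ k + y * b ^+ k.
  suff : [set z | exists x y, z = x * a ^+ k + y * b ^+ k] 1 by [].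
  apply: ideal_unit.
    split=> //.
    - by exists 0, 0; rewrite !mul0r addr0.
    - move=> _ _ [x [y ->]] [x' [y' ->]]; exists (x + x'), (y + y').
      by rewrite !mulrDl addrACA.
    - by move=> c _ _ [x [y ->]]; exists (c * x), (c * y); rewrite mulrDr !mulrA.
  apply/seteqP; split=> // p hp; apply: (@spec1 _ p); rewrite -ab1; apply: specD.
    by apply: (@specX _ _ k); apply: hp; exists 1, 0; rewrite mul1r mul0r addr0.
  by apply: (@specX _ _ k); apply: hp; exists 0, 1; rewrite mul1r mul0r add0r.
exists (y * b ^+ k).
  have -> : 1 - y * b ^+ k = x * a ^+ k by rewrite e1 addrK.
  by rewrite mulrACA -exprMn [b * a]mulrC; exact: JM.
move=> p Jp; split=> [Cp pe|pe].
  apply: (@spec1 _ p); rewrite e1; apply: specD => //; apply: specM.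
  by rewrite -(prednK k0) exprS mulrC; apply: specM; exact: ha.
case: (JC p Jp) => // Cp; exfalso; apply: pe; apply: specM.
by rewrite -(prednK k0) exprS mulrC; apply: specM; exact: hb.
Qed.

End Spectrum.

(** * Connected components of closed subsets of the spectrum *)

Section Components.
Variable R : comPzRingType.
Hypothesis noeR : noetherian [set: R].
Implicit Types (I J S : set R) (p q : spec R) (Z W : set (spec R)).

Lemma vanishing_ideal Z : ideal_in setT (vanishing Z).
Proof.
split=> //.
- by move=> p _; exact: spec0.
- by move=> x y hx hy p Zp; apply: specD; [exact: hx|exact: hy].
- by move=> a x _ hx p Zp; apply: specM; exact: hx.
Qed.

Lemma connected_component_subset (T : topologicalType) (A B : set T) x :
  A `<=` B -> connected_component A x `<=` connected_component B x.
Proof.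
move=> AB y Axy; apply: (@connected_component_max _ _ (connected_component A x)) => //.
- apply: connected_component_refl; apply: connected_component_sub.
  exact: connected_component_sym Axy.
- exact: subset_trans (@connected_component_sub _ _ _) AB.
- exact: component_connected.
Qed.

(** Noetherian induction on the closed set: a disconnected one is the union of
    two smaller closed sets, and a connected one has at most one component. *)
Lemma finite_components_cover Z : closed Z ->
  exists s : seq (spec R), forall p, Z p ->
    exists2 q, q \in s & connected_component Z q p.
Proof.
pose good Z := exists s : seq (spec R), forall p, Z p ->
    exists2 q, q \in s & connected_component Z q p.
move=> cZ; apply: contrapT => badZ.
pose F := [set I | ideal_in setT I /\ ~ good (zeros I)].
have [||I [Iid Ibad] Imax] := noeR (F := F).
- exists (vanishing Z); split; first exact: vanishing_ideal.
  by rewrite zeros_vanishing.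
- by move=> I [].
have smaller B : closed B -> B `<=` zeros I -> B <> zeros I -> good B.
  move=> cB BI BI'; apply: contrapT => bB; apply: BI'.
  have <- : vanishing B = I.
    apply: Imax.
      by split; [exact: vanishing_ideal|rewrite zeros_vanishing].
    by move=> r Ir p /BI; exact.
  by rewrite zeros_vanishing.
apply: Ibad; have [cI|/existsNP[B]] := pselect (connected (zeros I)).
  have [[q Iq]|I0] := pselect (zeros I !=set0).
    exists [:: q] => p Ip; exists q; rewrite ?inE //.
    by rewrite connected_component_id.
  by exists [::] => p Ip; exfalso; apply: I0; exists p.
move=> /not_implyP[[b Bb] /not_implyP[[C oC BC] /not_implyP[[D cD BD] BI]]].
have sB : B `<=` zeros I by rewrite BC; exact: subIsetl.
have [||//|s1 h1] := smaller B.
- by rewrite BD; apply: closedI => //; exact: closed_zeros.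
- by [].
have [||h|s2 h2] := smaller (zeros I `\` B).
- have -> : zeros I `\` B = zeros I `&` ~` C.
    apply/seteqP; rewrite BC; split=> p [Ip h]; split=> //.
      by move=> Cp; apply: h.
    by case.
  by apply: closedI; [exact: closed_zeros|exact: open_closedC].
- exact: subDsetl.
- by have : zeros I b := sB _ Bb; rewrite -h => -[].
exists (s1 ++ s2) => p Ip; have [Bp|Bp] := pselect (B p).
  have [q qs hq] := h1 p Bp; exists q; first by rewrite mem_cat qs.
  exact: connected_component_subset hq.
have [|q qs hq] := h2 p; first by split.
exists q; first by rewrite mem_cat qs orbT.
by apply: connected_component_subset hq; exact: subDsetl.
Qed.

Lemma finite_pi0 Z : closed Z -> finite_set (pi0 Z).
Proof.
move=> /finite_components_cover[s hs].
apply: (@sub_finite_set _ _ (connected_component Z @` [set` s])).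
  move=> W [p Zp ->]; have [q qs hq] := hs p Zp.
  by exists q => //; exact: same_connected_component.
by apply: finite_image; exact: finite_seq.
Qed.

Lemma pi0_closed Z W : closed Z -> pi0 Z W -> closed W.
Proof. by move=> cZ [p _ ->]; exact: component_closed. Qed.

Lemma pi0_sub Z W : pi0 Z W -> W `<=` Z.
Proof. by move=> [p _ ->]; exact: connected_component_sub. Qed.

Lemma pi0_eq Z W W' p : pi0 Z W -> pi0 Z W' -> W p -> W' p -> W = W'.
Proof.
move=> [q Zq ->] [q' Zq' ->] h h'.
by rewrite (same_connected_component h) (same_connected_component h').
Qed.

Lemma pi0_nonempty Z W : pi0 Z W -> W !=set0.
Proof. by move=> [p Zp ->]; exists p; exact: connected_component_refl. Qed.

End Components.

(** * Translates of sets of primes *)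

Section Translates.
Variables (R : comPzRingType) (s : ring_aut R).
Implicit Types (p q : spec R) (Z W : set (spec R)) (m n : int).

Lemma XiD m n p : Xi s m (Xi s n p) = Xi s (m + n) p.
Proof.
by apply: spec_ext; apply/seteqP; split=> r /=; rewrite addrC autzD.
Qed.

Lemma Xi0 p : Xi s 0 p = p.
Proof. by apply: spec_ext; apply/seteqP; split. Qed.

Lemma XiK n : cancel (Xi s n) (Xi s (- n)).
Proof. by move=> p; rewrite XiD addNr Xi0. Qed.

Lemma XiNK n : cancel (Xi s (- n)) (Xi s n).
Proof. by move=> p; rewrite XiD subrr Xi0. Qed.

Lemma XiE n W p : (Xi s n @` W) p <-> W (Xi s (- n) p).
Proof.
split=> [[q Wq <-]|Wp]; first by rewrite XiK.
by exists (Xi s (- n) p); rewrite ?XiNK.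
Qed.

Lemma Xi_image n W : Xi s n @` W = Xi s (- n) @^-1` W.
Proof. by apply/seteqP; split=> p /XiE. Qed.

Lemma Xi_imageD m n W : Xi s m @` (Xi s n @` W) = Xi s (m + n) @` W.
Proof.
by apply/seteqP; split=> p; rewrite !XiE XiD opprD addrC.
Qed.

Lemma Xi_image0 W : Xi s 0 @` W = W.
Proof. by apply/seteqP; split=> p; rewrite XiE oppr0 Xi0. Qed.

Lemma Xi_continuous n : continuous (Xi s n).
Proof.
apply/continuousP => U [S ->]; exists (autz s n @` S).
apply/seteqP; split=> p /= h hS; apply: h.
  by move=> x Sx; apply: hS; exists x.
by move=> _ [x Sx <-]; exact: hS.
Qed.

Lemma Xi_image_closed n W : closed W -> closed (Xi s n @` W).
Proof.
rewrite Xi_image => cW; apply: closed_comp => // p _; exact: Xi_continuous.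
Qed.

Lemma Xi_image_connected n W : connected W -> connected (Xi s n @` W).
Proof.
move=> cW; apply: connected_continuous_connected => //.
exact/continuous_subspaceT/Xi_continuous.
Qed.

End Translates.

(** * The translates of the components of Z *)

Section Pieces.
Variables (R : comPzRingType) (s : ring_aut R) (v : R).
Hypothesis noeR : noetherian [set: R].
Hypothesis star : condition_star s v.
Notation Z := (Zv v).
Implicit Types (W : set (spec R)) (m n : int) (p : spec R).

Lemma Zv_closed : closed Z.
Proof. exact: closed_zeros. Qed.

(** A subset of [W] which is itself a component of [Z] is all of [W]. *)
Lemma star_sub W n p : pi0 Z W -> W p -> (Xi s n @` Z) p -> W `<=` Xi s n @` Z.
Proof.
move=> hW Wp hp; have [[E|E] _] := (proj1 (star hW) n, tt).
  by have : (W `&` Xi s n @` Z) p by []; rewrite E.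
suff <- : W `&` Xi s n @` Z = W by exact: subIsetr.
exact: pi0_eq E hW (conj Wp hp) Wp.
Qed.

(** By [star_sub] the translate [Xi^(-n) W] is contained in [Z]; being connected
    it lies in a component [W'] of [Z].  The same argument for [W'] shows that
    [Xi^n W'] is a connected subset of [Z] meeting [W], so it lies in [W]. *)
Lemma star_translate W n p : pi0 Z W -> W p -> (Xi s n @` Z) p ->
  pi0 Z (Xi s (- n) @` W).
Proof.
move=> hW Wp hp; have WnZ := star_sub hW Wp hp.
have sub W1 m : W1 `<=` Xi s m @` Z -> Xi s (- m) @` W1 `<=` Z.
  move=> h _ [q /h/XiE hq <-]; exact: hq.
have con W1 : pi0 Z W1 -> connected W1.
  by move=> [q _ ->]; exact: component_connected.
pose q := Xi s (- n) p; have Wq : (Xi s (- n) @` W) q by exists p.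
have Zq : Z q by exact: sub WnZ _ Wq.
exists q => //; set W' := connected_component Z q.
have hW' : pi0 Z W' by exists q.
have W'q : W' q by exact: connected_component_refl.
apply/seteqP; split.
  apply: connected_component_max => //; first exact: sub.
  exact/Xi_image_connected/con.
have hq : (Xi s (- n) @` Z) q by exists p => //; exact: pi0_sub Wp.
have W'nZ := star_sub hW' W'q hq.
have : Xi s n @` W' `<=` W.
  case: (hW) => p0 _ Wp0; have -> : W = connected_component Z p.
    by rewrite Wp0; apply: same_connected_component; rewrite -Wp0.
  apply: connected_component_max.
  - by exists q => //; exact: XiNK.
  - by rewrite -[n]opprK; exact: sub.
  - exact/Xi_image_connected/con.
by move=> h r W'r; apply/XiE; rewrite opprK; apply: h; exists r.
Qed.

Lemma pieces_meet W1 W2 m n p : pi0 Z W1 -> pi0 Z W2 ->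
  (Xi s m @` W1) p -> (Xi s n @` W2) p -> W2 = Xi s (m - n) @` W1.
Proof.
move=> h1 h2 /XiE p1 /XiE p2.
have e : Xi s (- n) p = Xi s (m - n) (Xi s (- m) p).
  by rewrite XiD addrC addrA addNr add0r.
have p2' : (Xi s (m - n) @` W1) (Xi s (- n) p).
  by rewrite e; exists (Xi s (- m) p).
apply: (pi0_eq h2 _ p2 p2').
rewrite -[m - n]opprK; apply: (star_translate h1 p1).
by apply/XiE; rewrite opprK -e; exact: (pi0_sub h2 p2).
Qed.

(** A component equal to its translate by [n] would meet [Xi^k Z] for all
    multiples [k] of [n], among which there are arbitrarily large ones. *)
Lemma aperiodic W n : pi0 Z W -> Xi s n @` W = W -> n = 0.
Proof.
move=> hW e.
have iterW k : Xi s (n * k%:Z) @` W = W.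
  elim: k => [|k IH]; first by rewrite mulr0 Xi_image0.
  by rewrite intS mulrDr mulr1 -Xi_imageD IH.
have iterW' k : Xi s (- (n * k%:Z)) @` W = W.
  by rewrite -{1}(iterW k) Xi_imageD addNr Xi_image0.
have [N hN] := proj2 (star hW); have [p Wp] := pi0_nonempty hW.
case: (eqVneq n 0) => // n0; exfalso.
have [k [hk e']] : exists k : int, (N <= k)%R /\ Xi s k @` W = W.
  have h : (N <= `|n * `|N|%N%:Z|)%R.
    rewrite normrM; apply: le_trans (ler_norm N) _.
    have -> : `| (`|N|%N : int)| = `|N| by rewrite abszE normr_id.
    by apply: ler_peMl; rewrite ?normr_ge0 // -gtz0_ge1 normr_gt0.
  have [h0|h0] := leP 0 (n * `|N|%N%:Z).
    by exists (n * `|N|%N%:Z); split; [move: h; rewrite ger0_norm|].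
  by exists (- (n * `|N|%N%:Z)); split; [move: h; rewrite ltr0_norm|].
have : (W `&` Xi s k @` Z) p.
  by split=> //; move: Wp; rewrite -{1}e' => -[q Wq <-]; exists q => //; exact: pi0_sub Wq.
by rewrite hN.
Qed.

Variable rep : {w | blocks s v w} -> set (spec R).
Hypothesis rep_in : forall w, sval w (rep w).
Notation block := {w | blocks s v w}.
Implicit Types (w : block).

Lemma rep_pi0 w : pi0 Z (rep w).
Proof. by have [W _ e] := svalP w; have := rep_in w; rewrite -e => -[]. Qed.

Lemma block_eq w : sval w = block_of s v (rep w).
Proof.
have [W hW e] := svalP w; have := rep_in w; rewrite -e => -[_ [n ->]].
apply/seteqP; split=> W' [hW' [m e']]; split=> //; rewrite e'.
  by exists (m - n); rewrite Xi_imageD subrK.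
by exists (m + n); rewrite -Xi_imageD.
Qed.

Lemma sval_inj (T : Type) (P : T -> Prop) : injective (@sval T P).
Proof.
move=> [x Px] [y Py] /= xy; subst y; congr exist; exact: Prop_irrelevance.
Qed.

Lemma pieces_disjoint w1 w2 m n p :
  (Xi s m @` rep w1) p -> (Xi s n @` rep w2) p -> w1 = w2 /\ m = n.
Proof.
move=> h1 h2; have e := pieces_meet (rep_pi0 w1) (rep_pi0 w2) h1 h2.
have w12 : w1 = w2.
  apply: sval_inj; rewrite !block_eq e.
  apply/seteqP; split=> W' [hW' [k e']]; split=> //; rewrite e'.
    by exists (k - (m - n)); rewrite Xi_imageD subrK.
  by exists (k + (m - n)); rewrite Xi_imageD.
split=> //; apply/eqP; rewrite -subr_eq0; apply/eqP.
by apply: (aperiodic (rep_pi0 w1)); rewrite -e w12.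
Qed.

Lemma pi0_piece W : pi0 Z W -> exists w n, W = Xi s n @` rep w.
Proof.
move=> hW; pose w : block := exist _ (block_of s v W) (ex_intro2 _ _ W hW erefl).
have := rep_in w => -[_ [n e]].
by exists w, (- n); rewrite e Xi_imageD addNr Xi_image0.
Qed.

Lemma Zv_finite_pieces : exists L : seq ({classic block} * int), forall p, Z p ->
  exists2 wn, wn \in L & (Xi s wn.2 @` rep wn.1) p.
Proof.
have /finite_seqP[S hS] := finite_pi0 noeR Zv_closed.
have [L hL] : exists L : seq ({classic block} * int), forall W, W \in S ->
    pi0 Z W -> exists2 wn, wn \in L & W = Xi s wn.2 @` rep wn.1.
  elim: (S) => [|W S' [L hL]]; first by exists [::].
  have [/pi0_piece[w [n e]]|hW] := pselect (pi0 Z W).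
    exists ((w : {classic block}, n) :: L) => W'; rewrite inE => /orP[/eqP -> _|W'S hW'].
      by exists (w : {classic block}, n); rewrite ?inE ?eqxx.
    have [wn wnL e'] := hL W' W'S hW'; exists wn => //.
    by rewrite inE wnL orbT.
  by exists L => W'; rewrite inE => /orP[/eqP ->//|]; exact: hL.
exists L => p Zp; have hW : pi0 Z (connected_component Z p) by exists p.
have [|wn wnL e] := hL (connected_component Z p) _ hW.
  by have : [set` S] (connected_component Z p) by rewrite -hS.
by exists wn => //; rewrite -e; exact: connected_component_refl.
Qed.

(** The union of the [Xi^j Z] with [j < n] bounds the supports of the elements
    killed by [t_-^n]; see [lsupp_nilpotent]. *)
Lemma translates_finite_pieces (n : nat) : exists L : seq ({classic block} * int),
  forall p, (exists2 j : nat, (j < n)%N & (Xi s j%:Z @` Z) p) ->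
    exists2 wn, wn \in L & (Xi s wn.2 @` rep wn.1) p.
Proof.
have [L hL] := Zv_finite_pieces.
exists [seq (wn.1, j%:Z + wn.2) | j <- iota 0 n, wn <- L] => p [j jn /XiE hp].
have [wn wnL hwn] := hL _ hp.
have {}hwn : (Xi s j%:Z @` (Xi s wn.2 @` rep wn.1)) p by apply/XiE.
exists (wn.1, j%:Z + wn.2); last by rewrite Xi_imageD in hwn.
by apply: (allpairs_f (fun j wn => (wn.1, j%:Z + wn.2))) => //; rewrite mem_iota.
Qed.

Lemma finite_blocks : exists L : seq {classic block}, forall w, w \in L.
Proof.
have : finite_set (blocks s v) by apply/finite_image/finite_pi0/Zv_closed.
move=> /finite_seqP[S hS].
have [[w0]|noblock] := pselect (inhabited block); last first.
  by exists [::] => w; exfalso; apply: noblock.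
pose f B : {classic block} :=
  if pselect (blocks s v B) is left h then exist _ B h else w0.
exists (map f S) => w; have -> : w = f (sval w).
  by rewrite /f; case: pselect => h; [exact: sval_inj|case: h; exact: svalP].
by apply: map_f; have : [set` S] (sval w) by rewrite -hS; exact: svalP.
Qed.

Lemma rep_union_closed : closed (\bigcup_w rep w).
Proof.
have [L hL] := finite_blocks.
apply: (@closed_bigcup _ {classic block} setT rep).
  by apply: (@sub_finite_set _ _ [set` L]); [move=> w _; exact: hL|exact: finite_seq].
by move=> w _; apply: pi0_closed (rep_pi0 w); exact: Zv_closed.
Qed.

End Pieces.

(** * Supports of elements of A-modules *)

Section Support.
Variables (R : comPzRingType) (s : ring_aut R) (v : R).
Hypothesis noeR : noetherian [set: R].
Notation A := (gwa s v).
Notation gR := (@gR R s v).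
Notation tm := (tm s v).
Notation tp := (tp s v).
Notation Z := (Zv v).
Implicit Types (M N : lmodType A) (p : spec R) (r : R) (C : set (spec R)).

Definition lann M (x : M) : set R := [set r | gR r *: x = 0].
Definition lsupp M (x : M) : set (spec R) := zeros (lann x).

Lemma lann_ideal M (x : M) : ideal_in setT (lann x).
Proof.
split=> // [|r r' hr hr'|a r _ hr].
- by rewrite /lann /= rmorph0 scale0r.
- by rewrite /lann /= rmorphD scalerDl hr hr' addr0.
- by rewrite /lann /= rmorphM -scalerA hr scaler0.
Qed.

Lemma lsupp_eq0 M (x : M) : lsupp x = set0 -> x = 0.
Proof.
move=> x0; have := ideal_unit noeR (lann_ideal x) x0.
by rewrite /lann /= rmorph1 scale1r.
Qed.

Lemma lsupp0 M : lsupp (0 : M) = set0.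
Proof.
apply/seteqP; split=> // p /(_ 1) h; apply: (@spec1 _ p); apply: h.
exact: scaler0.
Qed.

Lemma lsuppN M (x : M) : lsupp (- x) `<=` lsupp x.
Proof. by move=> p hp r rx; apply: hp; rewrite /lann /= scalerN rx oppr0. Qed.

Lemma lsuppD M (x y : M) C : lsupp x `<=` C -> lsupp y `<=` C -> lsupp (x + y) `<=` C.
Proof.
move=> xC yC p hp; apply: contrapT => Cp.
have /existsNP[r /not_implyP[rx pr]] : ~ lsupp x p by move=> /xC.
have /existsNP[r' /not_implyP[ry pr']] : ~ lsupp y p by move=> /yC.
have : spec_set p (r * r').
  apply: hp; rewrite /lann /= scalerDr {1}mulrC !rmorphM -!scalerA.
  by rewrite rx ry !scaler0 addr0.
by case/spec_prime.
Qed.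

Lemma lsupp_sum M (T : eqType) (L : seq T) (f : T -> M) C :
  (forall i, i \in L -> lsupp (f i) `<=` C) -> lsupp (\sum_(i <- L) f i) `<=` C.
Proof.
elim: L => [|i L IH] h; first by rewrite big_nil lsupp0.
rewrite big_cons; apply: lsuppD; first by apply: h; rewrite inE eqxx.
by apply: IH => j jL; apply: h; rewrite inE jL orbT.
Qed.

Lemma lsupp_gR M (x : M) r : lsupp (gR r *: x) `<=` lsupp x.
Proof.
move=> p hp r' r'x; apply: hp; rewrite /lann /= scalerA -rmorphM mulrC.
by rewrite rmorphM -scalerA r'x scaler0.
Qed.

(** Homogeneous elements of [A] commute with [R] up to a power of the
    automorphism. *)
Lemma lsuppZ M (x : M) i (a : A) : gdeg i a -> lsupp (a *: x) `<=` Xi s i @` lsupp x.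
Proof.
move=> ha p hp; apply/XiE => r rx /=; apply: hp; rewrite /lann /=.
by rewrite scalerA -(gdeg_comm ha) -autzD subrr -scalerA rx scaler0.
Qed.

Lemma lsupp_linear M N (f : {linear M -> N}) x : lsupp (f x) `<=` lsupp x.
Proof. by move=> p hp r rx; apply: hp; rewrite /lann /= -linearZ rx linear0. Qed.

Lemma lsupp_inj M N (f : {linear M -> N}) x : injective f -> lsupp x `<=` lsupp (f x).
Proof.
move=> finj p hp r; rewrite /lann /= -linearZ => rx; apply: hp.
by apply: finj; rewrite rx linear0.
Qed.

(** If [r] kills [t_- x] then [sigma^(-1)(r) v = sigma^(-1)(r) t_+ t_- = t_+ r t_-]
    kills [x]. *)
Lemma lsupp_tm M (x : M) p : lsupp x p ->
  Z p \/ lsupp (tm *: x) (Xi s (-1) p).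
Proof.
move=> hp; have [Zp|/existsNP[_ /not_implyP[-> pv]]] := pselect (Z p); first by left.
right=> r rx /=.
have : spec_set p (autV s r * v).
  apply: hp; rewrite /lann /=.
  have -> : gR (autV s r * v) = tp * gR r * tm.
    by rewrite -{2}(autVK s r) -gR_tp -mulrA tp_tm -rmorphM.
  by rewrite -!scalerA rx scaler0.
by case/spec_prime.
Qed.

Lemma lsupp_nilpotent M (x : M) n p : tm ^+ n *: x = 0 -> lsupp x p ->
  exists2 j : nat, (j < n)%N & (Xi s j%:Z @` Z) p.
Proof.
elim: n x p => [|n IH] x p; first by rewrite scale1r => ->; rewrite lsupp0.
rewrite exprSr -scalerA => hx /lsupp_tm[Zp|hp].
  by exists 0%N; rewrite // Xi_image0.
have [j jn hj] := IH _ _ hx hp; exists j.+1; rewrite // intS -Xi_imageD.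
by exists (Xi s (-1) p); rewrite ?XiNK.
Qed.

Section Decomposition.
Variables (T : choiceType) (C : T -> set (spec R)).
Hypothesis Cdisj : forall i j p, C i p -> C j p -> i = j.

(** The support of [f i] lies in [C i], and also in the union of the other sets
    since [f i] is minus the sum of the other terms; so it is empty. *)
Lemma lsupp_independent M (L : seq T) (f : T -> M) : uniq L ->
  (forall i, i \in L -> lsupp (f i) `<=` C i) -> \sum_(i <- L) f i = 0 ->
  forall i, i \in L -> f i = 0.
Proof.
move=> uL hf sf i iL; apply: lsupp_eq0; apply/seteqP; split=> // p hp.
have Cip := hf i iL p hp.
move: sf; rewrite (bigD1_seq i) //= => /eqP; rewrite addr_eq0 => /eqP fi.
rewrite fi in hp; move: hp => /lsuppN; rewrite -big_filter.
move=> /(@lsupp_sum _ _ _ _ (~` C i)); apply=> // j; rewrite mem_filter.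
move=> /andP[ji jL] q /(hf j jL) Cjq Ciq.
by move: ji; rewrite (Cdisj Cjq Ciq) eqxx.
Qed.

Lemma lsupp_split2 M (x : M) C1 C2 : closed C1 -> closed C2 -> C1 `&` C2 = set0 ->
  lsupp x `<=` C1 `|` C2 ->
  exists e, lsupp (gR e *: x) `<=` C1 /\ lsupp (gR (1 - e) *: x) `<=` C2.
Proof.
move=> cC1 cC2 C12 xC.
have [e he eC] := split_idempotent noeR (lann_ideal x) cC1 cC2 C12 xC.
exists e; split=> p hp.
  have xp := lsupp_gR hp; apply/(eC p xp) => pe; apply: (@spec1 _ p).
  rewrite -[1](subrK e); apply: specD => //; apply: hp.
  by rewrite /lann /= scalerA -rmorphM mulrC.
have xp := lsupp_gR hp; case: (xC p xp) => // /(eC p xp) pe; exfalso; apply: pe.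
by apply: hp; rewrite /lann /= scalerA -rmorphM.
Qed.

Hypothesis Ccl : forall i, closed (C i).

(** The summands are multiples of [x] by elements of [R], hence belong to every
    R-submodule containing [x]; in particular they are homogeneous when [x] is. *)
Lemma lsupp_decomposition M (L : seq T) (x : M) : uniq L ->
  lsupp x `<=` [set p | exists2 i, i \in L & C i p] ->
  exists e : T -> R, x = \sum_(i <- L) gR (e i) *: x /\
    forall i, i \in L -> lsupp (gR (e i) *: x) `<=` C i.
Proof.
elim: L x => [|i L IH] x.
  move=> _ h; exists (fun=> 0); split=> //; rewrite big_nil.
  by apply: lsupp_eq0; apply/seteqP; split=> // p /h[].
move=> /= /andP[iL uL] h.
have cL : closed [set p | exists2 i, i \in L & C i p].
  exact: (@closed_bigcup _ T [set` L] C (finite_seq L) (fun i _ => @Ccl i)).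
have [||e0 [h1 h2]] := lsupp_split2 (x := x) (@Ccl i) cL.
- apply/seteqP; split=> // p [Ci [j jL Cj]].
  by move: iL; rewrite (Cdisj Ci Cj) jL.
- move=> p /h[j]; rewrite inE => /orP[/eqP ->|jL] Cj; first by left.
  by right; exists j.
have [e [xe he]] := IH _ uL h2.
exists (fun j => if j == i then e0 else e j * (1 - e0)); split.
  rewrite big_cons eqxx (eq_big_seq (fun j => gR (e j) *: (gR (1 - e0) *: x))).
    by rewrite -xe -scalerDl -rmorphD addrC subrK rmorph1 scale1r.
  move=> j jL /=; case: eqP => [ji|_]; first by move: iL; rewrite -ji jL.
  by rewrite rmorphM scalerA.
move=> j; rewrite inE; case: eqP => [->//|_] /= jL.
by rewrite rmorphM -scalerA; exact: he.
Qed.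

End Decomposition.

End Support.

(** * Equivalences of categories *)

Lemma equivalence_of_fully_faithful (C D : category) (F : functor C D) :
  (forall x y (f g : mor x y), fhom F f = fhom F g -> f = g) ->
  (forall x y (g : mor (F x) (F y)), exists f, fhom F f = g) ->
  (forall d : D, exists c, isomorphic (F c) d) -> is_equivalence F.
Proof.
move=> faith full es.
pose G0 d := sval (cid (es d)).
pose i d : mor (F (G0 d)) d := sval (cid (svalP (cid (es d)))).
have ex_j d : exists j, compm j (i d) = idm _ /\ compm (i d) j = idm _.
  exact: (svalP (cid (svalP (cid (es d))))).
pose j d := sval (cid (ex_j d)).
have ji d : compm (j d) (i d) = idm _ by case: (svalP (cid (ex_j d))).
have ij d : compm (i d) (j d) = idm _ by case: (svalP (cid (ex_j d))).
pose lift x y (g : mor (F x) (F y)) := sval (cid (full x y g)).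
have liftE x y (g : mor (F x) (F y)) : fhom F (lift x y g) = g.
  exact: (svalP (cid (full x y g))).
pose G1 d e (f : mor d e) := lift (G0 d) (G0 e) (compm (j e) (compm f (i d))).
have G11 d : G1 d d (idm d) = idm (G0 d).
  by apply: faith; rewrite liftE comp1m ji fhom1.
have G1M d e f (g : mor e f) (h : mor d e) :
    G1 d f (compm g h) = compm (G1 e f g) (G1 d e h).
  apply: faith; rewrite fhomM !liftE !compmA.
  by rewrite -(compmA _ (i e) (j e)) ij compm1.
pose G := Functor G11 G1M.
exists G; split.
  exists (fun x => lift (G0 (F x)) x (i (F x))); split.
    move=> x y f; apply: faith; rewrite /= !fhomM !liftE.
    by rewrite !compmA ij comp1m.
  move=> x; exists (lift x (G0 (F x)) (j (F x))).
  by split; apply: faith; rewrite fhomM !liftE fhom1 ?ji ?ij.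
exists i; split.
  by move=> x y f; rewrite /= liftE !compmA ij comp1m.
by move=> d; exists (j d); split; [exact: ji|exact: ij].
Qed.

(** * Graded modules, maps and direct sums *)

Section GradedModules.
Variables (R : comPzRingType) (s : ring_aut R) (v : R).
Notation A := (gwa s v).
Notation grmod := (@grmod R s v).
Implicit Types (M N : grmod).

Lemma hcomp_homog M (x : M) i j : deg M i x -> hcomp x j = if j == i then x else 0.
Proof.
move=> hx; pose f k := if k == i then x else 0.
have hf k : deg M k (f k).
  by rewrite /f; case: eqP => [->//|_]; exact: deg0.
rewrite (@hcomp_uniq _ _ _ M x [:: i] f _ hf); last first.
- by rewrite big_seq1 /f eqxx.
- by [].
by rewrite inE /f; case: eqP.
Qed.

Lemma deg_gR M (x : M) i r : deg M i x -> deg M i (gR s v r *: x).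
Proof. by move=> hx; rewrite -(add0r i); apply: grZ hx; exact: gdegR. Qed.

Lemma hcomp_grhom M N (f : grhom M N) (x : M) i : hcomp (f x) i = f (hcomp x i).
Proof.
rewrite (@hcomp_uniq _ _ _ N (f x) (hsupp x) (fun i => f (hcomp x i))).
- by case: ifP => // ix; rewrite /hcomp ix linear0.
- exact: hsupp_uniq.
- by move=> k; apply: gr_fun_deg; exact: hcomp_deg.
- by rewrite -linear_sum -(hcomp_sum (hsupp_uniq x) (fun i h => h)).
Qed.

Lemma hcomp_eq0 M (x : M) : (forall i, hcomp x i = 0) -> x = 0.
Proof.
move=> h; rewrite (hcomp_sum (hsupp_uniq x) (fun i h => h)).
by rewrite big1.
Qed.

Lemma inj_grhom_deg M N (f : grhom M N) : injective f ->
  forall i x, deg N i (f x) -> deg M i x.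
Proof.
move=> finj i x hfx; suff -> : x = hcomp x i by exact: hcomp_deg.
by apply: finj; rewrite -hcomp_grhom (hcomp_homog _ hfx) eqxx.
Qed.

Lemma surj_grhom M N (f : grhom M N) :
  (forall i y, deg N i y -> exists x, f x = y) -> forall y, exists x, f x = y.
Proof.
move=> h y; have /choice[g hg] : forall i, exists x, f x = hcomp y i.
  by move=> i; apply: h; exact: hcomp_deg.
exists (\sum_(i <- hsupp y) g i); rewrite linear_sum.
rewrite [RHS](hcomp_sum (hsupp_uniq y) (fun i h => h)).
by apply: eq_bigr => i _; rewrite hg.
Qed.

Section Inverse.
Variables (M N : grmod) (f : grhom M N).
Hypotheses (finj : injective f) (fsurj : forall y, exists x, f x = y).

(** A bijective graded map has a graded inverse: by [inj_grhom_deg] an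
    injective graded map reflects degrees. *)
Definition grinv_fun (y : N) : M := sval (cid (fsurj y)).

Lemma grinv_funK y : f (grinv_fun y) = y.
Proof. exact: (svalP (cid (fsurj y))). Qed.

Lemma grinv_linear : linear grinv_fun.
Proof. by move=> a x y; apply: finj; rewrite linearP !grinv_funK. Qed.

HB.instance Definition _ := GRing.isLinear.Build A N M *:%R grinv_fun grinv_linear.

Definition grinv : grhom N M.
Proof.
exists (grinv_fun : {linear N -> M}) => i y hy.
have h := @inj_grhom_deg M N f finj i (grinv_fun y).
by apply: h; rewrite grinv_funK.
Defined.

End Inverse.

Lemma Oplus_iso (M N : Oplus s v) (f : grhom (sval M) (sval N)) :
  injective f -> (forall y, exists x, f x = y) -> isomorphic M N.
Proof.
move=> finj fsurj; exists f; exists (grinv finj fsurj); split; apply: grhom_ext => x.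
  by apply: (finj); rewrite /= grinv_funK.
by rewrite /= grinv_funK.
Qed.

Definition grsub_incl M (S : grsub M) : grhom (grsubmod S) M.
Proof. by exists (val : {linear Defs.sub_type S -> M}). Defined.

Lemma grsub_incl_inj M (S : grsub M) : injective (grsub_incl S).
Proof. exact: val_inj. Qed.

Lemma quo_pi_linear M (S : grsub M) : linear (@quo_pi _ _ _ M S).
Proof. by move=> a x y; rewrite quo_piD; congr (_ + _); rewrite [RHS]quo_scaleE. Qed.

HB.instance Definition _ M S :=
  GRing.isLinear.Build A M (quo S) *:%R (@quo_pi _ _ _ M S) (@quo_pi_linear M S).

Definition grquo_proj M (S : grsub M) : grhom M (grquo S).
Proof.
by exists (@quo_pi _ _ _ M S : {linear M -> quo S}) => i x hx; exists x.
Defined.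

Definition grshift_hom M N (f : grhom M N) n : grhom (grshift M n) (grshift N n).
Proof.
refine (@GrHom _ _ _ (grshift M n) (grshift N n) (@gr_fun _ _ _ M N f) _) => i x.
exact: (@gr_fun_deg _ _ _ M N f (i + n) x).
Defined.

Section DirectSum.
Variables (I : Type) (M : I -> grmod).

Section Projection.
Variable i : I.

Definition dsum_at (x : dsum M) : M i := x i.

Lemma dsum_at_linear : linear dsum_at. Proof. by []. Qed.

HB.instance Definition _ :=
  GRing.isLinear.Build A (dsum M) (M i) *:%R dsum_at dsum_at_linear.

Definition dproj : grhom (grdsum M) (M i).
Proof. by exists (dsum_at : {linear grdsum M -> M i}) => k x /(_ i). Defined.

(** The index type carries no decidable equality, so the component at [j] is
    obtained by transport along a proof of [i = j], when there is one. *)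
Definition inj_fun (x : M i) (j : I) : M j :=
  if pselect (i = j) is left e then eq_rect i M x j e else 0.

Lemma inj_fun_eq x : inj_fun x i = x.
Proof.
rewrite /inj_fun; case: pselect => // e.
by rewrite (Prop_irrelevance e erefl).
Qed.

Lemma inj_fun_neq x (j : I) : i <> j -> inj_fun x j = 0.
Proof. by rewrite /inj_fun; case: pselect. Qed.

Lemma inj_fun_fin x : finite_set [set j | inj_fun x j != 0].
Proof.
apply: (@sub_finite_set _ _ [set i]); last exact: finite_set1.
move=> j /= h; apply: contrapT => ji.
by move: h; rewrite inj_fun_neq ?eqxx // => ij; apply: ji.
Qed.

Definition dsum_inj (x : M i) : dsum M := DSum (inj_fun_fin x).

Lemma dsum_inj_linear : linear dsum_inj.
Proof.
move=> a x y; apply: dsum_ext => j /=; rewrite /inj_fun.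
by case: pselect => [e|_]; [case: j / e|rewrite scaler0 addr0].
Qed.

HB.instance Definition _ :=
  GRing.isLinear.Build A (M i) (dsum M) *:%R dsum_inj dsum_inj_linear.

Definition dinj : grhom (M i) (grdsum M).
Proof.
exists (dsum_inj : {linear M i -> grdsum M}) => k x hx j /=; rewrite /inj_fun.
by case: pselect => [e|_]; [case: j / e|exact: deg0].
Defined.

End Projection.

Definition dsupp (x : dsum M) : seq {classic I} :=
  undup (sval (cid (proj1 (@finite_seqP {classic I} _) (dsum_fin x)))).

Lemma dsupp_uniq x : uniq (dsupp x). Proof. exact: undup_uniq. Qed.

Lemma dsuppP (x : dsum M) (i : {classic I}) : (x i : M i) <> 0 -> i \in dsupp x.
Proof.
move=> /eqP xi; rewrite mem_undup; set h := cid _.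
by have : [set` sval h] i by rewrite -(svalP h).
Qed.

Lemma dsupp_notin (x : dsum M) (i : {classic I}) : i \notin dsupp x -> (x i : M i) = 0.
Proof. by move=> ix; apply: contrapT => /dsuppP; rewrite (negbTE ix). Qed.

Section Total.
Variables (N : grmod) (f : forall i : I, grhom (M i) N).

Definition dsum_total (x : dsum M) : N := \sum_(i <- dsupp x) f i (x i).

(** Terms outside the support of [x] vanish, so any duplicate-free list
    containing the support computes the same sum. *)
Lemma dsum_totalE (x : dsum M) (L : seq {classic I}) : uniq L ->
  (forall i : {classic I}, (x i : M i) <> 0 -> i \in L) ->
  dsum_total x = \sum_(i <- L) f i (x i).
Proof.
move=> uL hL.
have red (K : seq {classic I}) : \sum_(i <- K) f i (x i) =
    \sum_(i <- K | x i != 0 :> M i) f i (x i).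
  rewrite [RHS]big_mkcond; apply: eq_bigr => i _.
  by case: eqP => //= ->; rewrite linear0.
rewrite /dsum_total red [RHS]red -[LHS]big_filter -[RHS]big_filter.
apply: perm_big.
apply: uniq_perm; rewrite ?filter_uniq ?dsupp_uniq // => i.
rewrite !mem_filter; case: eqP => //= xi.
by rewrite (dsuppP xi) (hL _ xi).
Qed.

Lemma dsum_total_linear : linear dsum_total.
Proof.
move=> a x y; pose L := undup (dsupp (a *: x + y) ++ dsupp x ++ dsupp y).
have uL : uniq L by exact: undup_uniq.
rewrite !(@dsum_totalE _ L) // => [|i h|i h|i h].
- by rewrite scaler_sumr -big_split; apply: eq_bigr => i _; exact: linearP.
- by rewrite mem_undup !mem_cat (dsuppP h) !orbT.
- by rewrite mem_undup !mem_cat (dsuppP h) !orbT.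
- by rewrite mem_undup !mem_cat (dsuppP h).
Qed.

HB.instance Definition _ :=
  GRing.isLinear.Build A (dsum M) N *:%R dsum_total dsum_total_linear.

Definition grtotal : grhom (grdsum M) N.
Proof.
exists (dsum_total : {linear grdsum M -> N}) => k x hx.
rewrite /= /dsum_total; elim/big_ind: _ => [|y z hy hz|i _].
- exact: deg0.
- by rewrite -[z]opprK -[- z]sub0r; apply: grB => //; apply: grB => //; exact: deg0.
- by apply: gr_fun_deg; exact: hx.
Defined.

Lemma grtotal_inj (i : I) (x : M i) : grtotal (dinj i x) = f i x.
Proof.
rewrite /= (@dsum_totalE _ [:: i : {classic I}]) //.
  by rewrite big_seq1 /= inj_fun_eq.
move=> j /=; rewrite /inj_fun; case: pselect => // ij _.
by rewrite inE; apply/eqP.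
Qed.

End Total.

End DirectSum.

End GradedModules.

(** * Supports of graded modules *)

Section GradedSupport.
Variables (R : comPzRingType) (s : ring_aut R) (v : R).
Notation A := (gwa s v).
Notation gR := (@gR R s v).
Notation tm := (tm s v).
Notation tp := (tp s v).
Notation Z := (Zv v).
Notation grmod := (@grmod R s v).
Notation Oplus := (Oplus s v).
Implicit Types (M N : grmod) (p : spec R) (r : R) (C U : set (spec R)).

Lemma hcompD M (x y : M) i : hcomp (x + y) i = hcomp x i + hcomp y i.
Proof.
pose J := undup (hsupp x ++ hsupp y).
have uJ : uniq J by exact: undup_uniq.
have xJ : {subset hsupp x <= J} by move=> j jI; rewrite mem_undup mem_cat jI.
have yJ : {subset hsupp y <= J}.
  by move=> j jI; rewrite mem_undup mem_cat jI orbT.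
rewrite (@hcomp_uniq _ _ _ M (x + y) J (fun i => hcomp x i + hcomp y i) uJ).
- case: ifP => // /negbT iJ.
  by rewrite /hcomp (negbTE (contra (xJ i) iJ)) (negbTE (contra (yJ i) iJ)) addr0.
- move=> k; rewrite -[hcomp y k]opprK -[- hcomp y k]sub0r.
  by do 2!(apply: grB; try exact: hcomp_deg; try exact: deg0).
- by rewrite big_split /= -(hcomp_sum uJ xJ) -(hcomp_sum uJ yJ).
Qed.

Lemma hcomp_big M (T : Type) (L : seq T) (f : T -> M) i :
  hcomp (\sum_(j <- L) f j) i = \sum_(j <- L) hcomp (f j) i.
Proof.
by elim: L => [|j L IH]; rewrite ?big_nil ?hcomp0 // !big_cons hcompD IH.
Qed.

Lemma hcompZ M (x : M) k (a : A) i : gdeg k a ->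
  hcomp (a *: x) (k + i) = a *: hcomp x i.
Proof.
move=> ha; rewrite {1}(hcomp_sum (hsupp_uniq x) (fun i h => h)).
rewrite scaler_sumr hcomp_big.
rewrite (eq_bigr (fun j => if j == i then a *: hcomp x i else 0)).
  rewrite -big_mkcond -big_filter /=.
  have [ix|ix] := boolP (i \in hsupp x).
    by rewrite filter_pred1_uniq ?hsupp_uniq // big_seq1.
  rewrite /hcomp (negbTE ix) scaler0 big_filter big1 //.
move=> j _; rewrite (hcomp_homog _ (grZ ha (hcomp_deg x j))).
rewrite (can_eq (addKr k)) eq_sym.
by case: eqP => // ->.
Qed.

(** For [x] of degree [i] the annihilator for the right R-structure is the image
    by [sigma^i] of the left annihilator, so this says that the support for the
    right R-structure of each homogeneous element lies in [U]. *)
Definition supported U M : Prop :=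
  forall i (x : M), deg M i x -> lsupp x `<=` Xi s i @` U.

Lemma supported_sub U U' M : U `<=` U' -> supported U M -> supported U' M.
Proof. by move=> UU' h i x /h xU p /xU [q Uq <-]; exists q => //; exact: UU'. Qed.

Lemma supported_shift U M n : supported U M -> supported (Xi s n @` U) (grshift M n).
Proof. by move=> h i x hx; rewrite Xi_imageD; exact: h. Qed.

Lemma lsupp_scale_notin M (x : M) p r : lsupp x p -> ~ spec_set p r ->
  lsupp (gR r *: x) p.
Proof.
move=> hp pr r' r'x; have : spec_set p (r' * r).
  by apply: hp; rewrite /lann /= rmorphM -scalerA.
by case/spec_prime.
Qed.

Lemma grtotal_dinj_id (I : Type) (M : I -> grmod) (x : dsum M) :
  grtotal (fun i => dinj M i) x = x.
Proof.
apply: dsum_ext => i; rewrite -[LHS]/(dproj M i _) /= /dsum_total linear_sum.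
have [ix|ix] := boolP ((i : {classic I}) \in dsupp x); last first.
  have -> : x i = 0 by exact: dsupp_notin.
  rewrite big_seq big1 // => j jx; rewrite /= /dsum_at /=.
  by rewrite inj_fun_neq // => ji; rewrite -ji jx in ix.
rewrite (bigD1_seq (i : {classic I})) ?dsupp_uniq //=.
rewrite inj_fun_eq big1 ?addr0 // => j ji; rewrite /= /dsum_at /= inj_fun_neq //.
by move=> e; rewrite e eqxx in ji.
Qed.

(** Extensions are the only case with content: a prime in the support of [x] but
    not in that of its image in the quotient misses some [r] killing the image,
    and then it lies in the support of [r x], which comes from the submodule. *)
Lemma supported_thick U (G : Oplus -> Prop) :
  (forall M : Oplus, G M -> supported U (sval M)) ->
  forall M : Oplus, thick G M -> supported U (sval M).
Proof.
move=> GU M; elim=> {M}.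
- exact: GU.
- move=> M N [f [g [_ fg]]] _ h i x hx.
  pose f' : grhom (sval M) (sval N) := f; pose g' : grhom (sval N) (sval M) := g.
  have <- : f' (g' x) = x by have := congr1 (fun h : grhom _ _ => h x) fg.
  by apply: (subset_trans (@lsupp_linear _ _ _ _ _ f' _)); apply: h; exact: gr_fun_deg.
- move=> M N f finj _ h i x hx; apply: (subset_trans (lsupp_inj finj)).
  by apply: h; exact: gr_fun_deg.
- move=> M N f fsurj _ h i x hx; have [y _ yx] := fsurj x Logic.I.
  have <- : f (hcomp y i) = x by rewrite -hcomp_grhom yx (hcomp_homog _ hx) eqxx.
  by apply: (subset_trans (@lsupp_linear _ _ _ _ _ f _)); apply: h; exact: hcomp_deg.
- move=> M' M M'' f g finj gsurj fg _ h' _ h'' i x hx p xp.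
  have [|/existsNP[r /not_implyP[rx pr]]] := pselect (lsupp (g x) p).
    by apply: h''; exact: gr_fun_deg.
  have rp := lsupp_scale_notin xp pr.
  have : [set x | g x = 0] (gR r *: x).
    by rewrite /= linearZ.
  rewrite -fg => -[y _ yx]; rewrite -yx in rp.
  apply: (h' i y); last exact: (lsupp_linear rp).
  apply: (inj_grhom_deg finj); rewrite yx.
  exact: deg_gR.
- move=> I M _ h i x hx; rewrite -(grtotal_dinj_id x) /= /dsum_total.
  apply: lsupp_sum => j _; apply: (subset_trans (@lsupp_linear _ _ _ _ _ (dinj _ j) _)).
  by apply: h; exact: hx.
Qed.

(** The elements whose homogeneous components are supported on [C] for the right
    R-structure. *)
Definition part_pred M C : pred M :=
  fun x => `[< forall i, lsupp (hcomp x i) `<=` Xi s i @` C >].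

Lemma part_homog M C i (x : M) : deg M i x -> lsupp x `<=` Xi s i @` C ->
  part_pred C x.
Proof.
move=> hx xC; apply/asboolP => j; rewrite (hcomp_homog _ hx).
by case: eqP => [->//|_]; rewrite lsupp0.
Qed.

Lemma part_closed M C : submod_closed (@part_pred M C).
Proof.
have D (x y : M) : part_pred C x -> part_pred C y -> part_pred C (x + y).
  move=> /asboolP hx /asboolP hy; apply/asboolP => i; rewrite hcompD.
  by apply: lsuppD; [exact: hx|exact: hy].
have h0 : part_pred C (0 : M).
  by apply/asboolP => i; rewrite hcomp0 lsupp0.
split=> // c x y hx hy; apply: (D) => //.
have [I [f [_ hf ->]]] := gwa_span c; rewrite scaler_suml.
elim: I => [|j I IH]; first by rewrite big_nil.
rewrite big_cons; apply: (D) => //; apply/asboolP => i.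
rewrite -(subrKC j i) (hcompZ _ _ (hf j)); apply: (subset_trans (lsuppZ (hf j))).
rewrite -Xi_imageD => p [q hq <-]; exists q => //.
by move/asboolP: hx; apply.
Qed.

Lemma part_hcomp M C (x : M) i : part_pred C x -> part_pred C (hcomp x i).
Proof.
by move=> /asboolP hx; apply: (@part_homog _ _ i); [exact: hcomp_deg|exact: hx].
Qed.

Definition part M C : grsub M := GrSub (@part_closed M C) (@part_hcomp M C).

Lemma part_supported M C : supported C (grsubmod (part M C)).
Proof.
move=> i x hx; apply: (subset_trans (lsupp_inj (@grsub_incl_inj _ _ _ _ _))).
have hx' : deg M i (sub_val x) by exact: hx.
by have /asboolP/(_ i) := sub_valP x; rewrite (hcomp_homog _ hx') eqxx.
Qed.

Lemma submod_nilpotent M (S : grsub M) :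
  locally_nilpotent M -> locally_nilpotent (grsubmod S).
Proof.
move=> h x; have [n hn] := h (sub_val x); exists n => k nk.
by apply: val_inj => /=; exact: hn.
Qed.

Lemma quomod_nilpotent M (S : grsub M) :
  locally_nilpotent M -> locally_nilpotent (grquo S).
Proof.
move=> h; elim/quo_ind=> x; have [n hn] := h x; exists n => k nk.
by rewrite -[RHS](linear0 (grquo_proj S)) -(hn k nk) [RHS]linearZ.
Qed.

Definition subO (M : Oplus) (S : grsub (sval M)) : Oplus :=
  exist _ (grsubmod S) (submod_nilpotent (svalP M)).

Definition quoO (M : Oplus) (S : grsub (sval M)) : Oplus :=
  exist _ (grquo S) (quomod_nilpotent (svalP M)).

Section Parts.
Hypothesis noeR : noetherian [set: R].
Variables (J : Type) (C : J -> set (spec R)).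
Hypothesis Cdisj : forall i j p, C i p -> C j p -> i = j.
Variable M : grmod.

(** The natural map to [M] from the direct sum of its parts. *)
Definition parts_total : grhom (grdsum (fun j => grsubmod (part M (C j)))) M :=
  grtotal (fun j => grsub_incl (part M (C j))).

Lemma parts_total_inj : injective parts_total.
Proof.
suff h x : parts_total x = 0 -> x = 0.
  by move=> x y e; apply/eqP; rewrite -subr_eq0; apply/eqP/h; rewrite linearB /= e subrr.
move=> x0; apply: dsum_ext => j; apply: val_inj => /=.
have [jx|jx] := boolP ((j : {classic J}) \in dsupp x); last first.
  by have -> : x j = 0 by exact: dsupp_notin.
apply: hcomp_eq0 => i.
have disj (a b : {classic J}) p : (Xi s i @` C a) p -> (Xi s i @` C b) p -> a = b.
  by move=> /XiE hj /XiE hk; exact: Cdisj hj hk.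
apply: (lsupp_independent noeR disj (L := dsupp x)
  (f := fun j : {classic J} => hcomp (sub_val (x j)) i)) => //.
- exact: dsupp_uniq.
- by move=> k _; have /asboolP := sub_valP (x k); exact.
- by rewrite -hcomp_big; have := congr1 (fun z => hcomp z i) x0; rewrite hcomp0.
Qed.

Hypothesis Ccl : forall j, closed (C j).
Hypothesis cover : forall i (x : M), deg M i x -> exists L : seq {classic J},
  lsupp x `<=` [set p | exists2 j, j \in L & (Xi s i @` C j) p].

Lemma parts_total_surj y : exists x, parts_total x = y.
Proof.
move: y; apply: surj_grhom => i y hy.
have [L hL] := cover hy.
have disj (a b : {classic J}) p : (Xi s i @` C a) p -> (Xi s i @` C b) p -> a = b.
  by move=> /XiE hj /XiE hk; exact: Cdisj hj hk.
have cl (j : {classic J}) : closed (Xi s i @` C j).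
  by apply: Xi_image_closed; exact: Ccl.
have [|e [ye he]] := lsupp_decomposition noeR disj cl (x := y) (undup_uniq L).
  by move=> p /hL[j jL hj]; exists j => //; rewrite mem_undup.
rewrite ye big_seq; elim/big_ind: _ => [|_ _ [x <-] [x' <-]|j jL].
- by exists 0; rewrite linear0.
- by exists (x + x'); rewrite linearD.
have hj : part M (C j) (gR (e j) *: y).
  apply: (@part_homog _ _ i); last exact: (he j jL).
  exact: deg_gR.
pose P k := grsubmod (part M (C k)).
exists (dinj P j (@Defs.SubType _ _ _ M (part M (C j)) _ hj)); exact: grtotal_inj.
Qed.

End Parts.

End GradedSupport.

(** * The subcategories generated by the modules P_{w,n} *)

Section Blocks.
Variables (R : comPzRingType) (s : ring_aut R) (v : R).
Notation A := (gwa s v).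
Notation gR := (@gR R s v).
Notation tm := (tm s v).
Notation tp := (tp s v).
Notation Z := (Zv v).
Notation grmod := (@grmod R s v).
Notation Oplus := (Oplus s v).
Notation Acyc := (@Acyc R s v).
Notation tm_ideal := (@tm_ideal R s v).
Implicit Types (p : spec R) (r : R) (C U W : set (spec R)).

Lemma ract_addr (M : grmod) (x : M) r r' : ract x (r + r') = ract x r + ract x r'.
Proof.
rewrite /ract -big_split; apply: eq_bigr => i _.
by rewrite !rmorphD scalerDl.
Qed.

Lemma ractM (M : grmod) (x : M) r r' : ract (ract x r) r' = ract x (r * r').
Proof.
rewrite [ract x r]/ract ract_sum [RHS]/ract; apply: eq_bigr => i _.
rewrite (ract_hom _ (deg_gR _ (hcomp_deg x i))).
by rewrite scalerA -!rmorphM [r * r']mulrC.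
Qed.

Lemma rann_ideal (M : grmod) : ideal_in setT (rann M).
Proof.
split=> // [x|r r' hr hr' x|a r _ hr x].
- by rewrite /ract big1 // => i _; rewrite !rmorph0 scale0r.
- by rewrite ract_addr hr hr' addr0.
- by rewrite -ractM hr.
Qed.

Definition cyc_one n : Acyc n := quo_pi (tm_ideal n) (1 : A).

Lemma cyc_oneE n (a : A) : quo_pi (tm_ideal n) a = a *: cyc_one n.
Proof.
have -> : a *: cyc_one n = grquo_proj (tm_ideal n) (a *: (1 : regmod s v)).
  by rewrite linearZ.
by rewrite /= [_ *: _]mulr1.
Qed.

Lemma cyc_one_deg n : deg (Acyc n) 0 (cyc_one n).
Proof. by exists 1 => //; rewrite -(rmorph1 gR); exact: gdegR. Qed.

Lemma cyc_one_nilpotent n : tm ^+ n *: cyc_one n = 0.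
Proof.
rewrite -cyc_oneE; apply/quo_piP; rewrite subr0.
by apply/asboolP; exists 1; rewrite mul1r.
Qed.

Lemma lann_cyc_one n r : lann (cyc_one n) r <-> rann (Acyc n) r.
Proof.
split=> h; last first.
  by have := h (cyc_one n); rewrite (ract_hom _ (cyc_one_deg n)).
elim/quo_ind=> a; rewrite cyc_oneE ractZ (ract_hom _ (cyc_one_deg n)).
by rewrite [X in gR X]/=  h scaler0.
Qed.

Lemma lann_cyc_oneP n r : lann (cyc_one n) r <-> exists b, gR r = b * tm ^+ n.
Proof.
rewrite /lann /= -cyc_oneE; split.
  by move=> /quo_piP; rewrite subr0 => /asboolP.
by move=> h; apply/quo_piP; rewrite subr0; apply/asboolP.
Qed.

(** The right R-structure commutes with the action of [A], so the annihilator of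
    the whole module is that of its generator, which is killed by [t_-^n]. *)
Lemma rsupp_Acyc n p : rsupp (Acyc n) p ->
  exists2 j : nat, (j < n)%N & (Xi s j%:Z @` Z) p.
Proof.
move=> hp; apply: (lsupp_nilpotent (cyc_one_nilpotent n)).
by move=> r /lann_cyc_one; exact: hp.
Qed.

Section CycMap.
Variables (M : grmod) (y : M) (n : nat) (k : int).
Hypotheses (ydeg : deg M (- k) y) (yn : tm ^+ n *: y = 0).

(** The map sending the class of [a] to [a *: y].  It exists because [t_-^n]
    kills [y]; the shift by [k] accounts for the degree [- k] of [y]. *)
Definition cyc_fun (q : Acyc n) : M := (repr q : A) *: y.

Lemma cyc_funE (a : A) : cyc_fun (quo_pi (tm_ideal n) a) = a *: y.
Proof.
apply/eqP; rewrite -subr_eq0 -scalerBl.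
have /asboolP[b ->] := @quo_repr _ _ _ _ (tm_ideal n) a.
by rewrite -scalerA yn scaler0.
Qed.

Lemma cyc_fun_linear : linear cyc_fun.
Proof.
move=> c; elim/quo_ind=> a; elim/quo_ind=> b.
have -> : c *: quo_pi (tm_ideal n) a + quo_pi (tm_ideal n) b =
    quo_pi (tm_ideal n) (c * a + b) by rewrite quo_piD; congr (_ + _); exact: quo_scaleE.
by rewrite !cyc_funE scalerDl scalerA.
Qed.

HB.instance Definition _ :=
  GRing.isLinear.Build A (Acyc n) M *:%R cyc_fun cyc_fun_linear.

Definition cyc_map : grhom (grshift (Acyc n) k) M.
Proof.
refine (@GrHom _ _ _ (grshift (Acyc n) k) M (cyc_fun : {linear Acyc n -> M}) _).
move=> i _ [a ha <-]; rewrite /= cyc_funE.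
by rewrite -(addrK k i); exact: grZ.
Defined.

End CycMap.

(** If [e] is a lift of the idempotent, [1 - e] kills the summand on the right;
    so a prime in the support of one of its elements misses [e]. *)
Lemma summand_supported (M : grmod) W :
  (exists e, rann M (e * e - e) /\
    forall p, rsupp M p -> (W p <-> ~ spec_set p e)) ->
  supported W (summand M W).
Proof.
move=> /(xgetPex 0); rewrite -/(one_at M W) => -[ee We] i x hx p hp.
pose S := GrSub (@summand_closed _ _ _ M W) (@summand_hcomp _ _ _ M W).
have /asboolP[y xy] := sub_valP x; set e := one_at M W in ee We xy.
have hx' : deg M i (sub_val x) by exact: hx.
have hp' : lsupp (sub_val x) p := lsupp_inj (@grsub_incl_inj _ _ _ M S) hp.
have xe : ract (sub_val x) e = sub_val x.
  by rewrite xy ractM -[e * e](subrK e) ract_addr ee add0r.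
apply/XiE; apply/We => [r rM /=|pe].
  by apply: hp'; rewrite /lann /= -(ract_hom r hx').
apply: (@spec1 _ p); rewrite -[1](subrK (autz s (- i) e)); apply: specD => //.
apply: hp'; rewrite /lann /= rmorphB rmorph1 scalerBl scale1r.
by rewrite -(ract_hom e hx') xe subrr.
Qed.

Hypothesis noeR : noetherian [set: R].
Hypothesis star : condition_star s v.

(** The support of A(n) lies in finitely many translates of components; those
    different from [W] form a closed set disjoint from [W]. *)
Lemma Acyc_idempotent W n : pi0 Z W ->
  exists e, rann (Acyc n) (e * e - e) /\
    forall p, rsupp (Acyc n) p -> (W p <-> ~ spec_set p e).
Proof.
move=> hW.
pose D : set (nat * set (spec R)) :=
  [set jW | [/\ (jW.1 < n)%N, pi0 Z jW.2 & Xi s jW.1%:Z @` jW.2 <> W]].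
(* The union of the translates of components which can occur, except [W]. *)
pose C2 := \bigcup_(jW in D) Xi s jW.1%:Z @` jW.2.
have cC2 : closed C2.
  apply: closed_bigcup => [|[j W'] [/= _ hW' _]].
    apply: (@sub_finite_set _ _ (`I_n `*` pi0 Z)).
      by move=> [j W'] [].
    by apply: finite_setX; [exact: finite_II|exact: (finite_pi0 noeR (@Zv_closed _ v))].
  by apply: Xi_image_closed; apply: pi0_closed hW'; exact: Zv_closed.
have cW : closed W by apply: pi0_closed hW; exact: Zv_closed.
have [||e he eW] := split_idempotent noeR (rann_ideal (Acyc n)) cW cC2.
- apply/seteqP; split=> // p [Wp [[j W'] [/= _ hW' ne] hp]]; apply: ne.
  have Wp0 : (Xi s 0 @` W) p by rewrite Xi_image0.
  by rewrite (pieces_meet star hW' hW hp Wp0) subr0.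
- move=> p /rsupp_Acyc[j jn hp].
  have [e|ne] := pselect (Xi s j%:Z @` connected_component Z (Xi s (- j%:Z) p) = W).
    left; rewrite -e; apply/XiE; apply: connected_component_refl.
    by move/XiE: hp.
  right; exists (j, connected_component Z (Xi s (- j%:Z) p)).
    split=> //; exists (Xi s (- j%:Z) p) => //; exact/XiE.
  apply/XiE; apply: connected_component_refl; exact/XiE.
exists e; split; last exact: eW.
have -> : e * e - e = -1 * (e * (1 - e)).
  by rewrite mulrBr mulr1 mulN1r opprB.
by have [_ _ _ h] := rann_ideal (Acyc n); exact: h.
Qed.

Variables (N : set (spec R) -> nat) (rep : {w | blocks s v w} -> set (spec R)).
Hypothesis N_large : forall W, pi0 Z W ->
  forall n : nat, (N W <= n)%N -> W `&` Xi s n%:Z @` Z = set0.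
Hypothesis rep_in : forall w, sval w (rep w).
Notation block := {w | blocks s v w}.

Lemma N_gt0 W : pi0 Z W -> (0 < N W)%N.
Proof.
move=> hW; rewrite lt0n; apply/eqP => NW0.
have [p Wp] := pi0_nonempty hW; have : (W `&` Xi s 0 @` Z) p.
  by rewrite Xi_image0; split=> //; exact: (pi0_sub hW).
by rewrite (N_large hW) // NW0.
Qed.

(** The shift by [n] moves the support by [Xi^n], and so cancels the translation
    by [Xi^(-n)] in the definition of [P_{w,n}]. *)
Lemma Pwn_supported w n : chi rep w n -> supported (rep w) (sval (Pwn N rep w n)).
Proof.
move=> hW; have hP := summand_supported (Acyc_idempotent (N (Xi s (- n) @` rep w)) hW).
have := @supported_shift _ _ _ _ _ n hP.
by rewrite Xi_imageD subrr Xi_image0.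
Qed.

Lemma Ow_supported w (M : Oplus) : Ow N rep w M -> supported (rep w) (sval M).
Proof.
by apply: supported_thick => P [n hn ->]; exact: Pwn_supported.
Qed.

Lemma thick_cover (G : Oplus -> Prop) (M : Oplus) (I : Type) (P : I -> Oplus)
  (f : forall i, grhom (sval (P i)) (sval M)) :
  (forall i, thick G (P i)) ->
  (forall y, exists x, grtotal f x = y) -> thick G M.
Proof.
move=> GP fsurj; apply: (@thick_quot _ _ _ G (dsumO P) M (grtotal f)).
  by move=> y _; have [x xy] := fsurj y; exists x.
exact: thick_dsum.
Qed.

Lemma thick_zero (G : Oplus -> Prop) (M : Oplus) :
  (forall x : sval M, x = 0) -> thick G M.
Proof.
move=> M0; pose P (i : False) : Oplus := match i with end.
pose f (i : False) : grhom (sval (P i)) (sval M) := match i with end.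
apply: (@thick_cover G M False P f) => [[]|y].
by exists 0; rewrite (M0 y) linear0.
Qed.


(** Either [y = 0], or its support is nonempty and contained both in [Z], as
    [v = t_+ t_-] kills [y], and in [Xi^(-n) W_w], so that the latter is a
    component [W] of [Z] and [P_{w,n}] is defined.  The generator of A(N W) is
    sent to [y], and [P_{w,n}] still maps onto the module because the idempotent
    of [W] vanishes at no prime of the support of [y], and hence is invertible
    on [y]. *)
Lemma killed_cyclic_in_Ow w n (M : Oplus) (y : sval M) :
  (forall x, exists a : A, x = a *: y) -> deg (sval M) (- n) y -> tm *: y = 0 ->
  lsupp y `<=` Xi s (- n) @` rep w -> Ow N rep w M.
Proof.
move=> gen ydeg ty yW.
have [y0|/eqP/set0P[p yp]] := pselect (lsupp y = set0).
  apply: thick_zero => x; have [a ->] := gen x.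
  by rewrite (lsupp_eq0 noeR y0) scaler0.
have Zp : Z p by move=> _ ->; apply: yp; rewrite /lann /= -tp_tm -scalerA ty scaler0.
pose W := Xi s (- n) @` rep w.
have hW : pi0 Z W.
  apply: (star_translate star (rep_pi0 rep_in w) (p := Xi s n p)).
    by rewrite -[X in Xi s X](opprK n); apply/XiE; exact: yW.
  by exists p.
pose m := N W; pose e := one_at (Acyc m) W.
have [_ We] := xgetPex 0 (Acyc_idempotent m hW); rewrite -/(one_at _ _) -/e in We.
have ym : tm ^+ m *: y = 0.
  have m0 : (0 < m)%N := N_gt0 hW.
  by rewrite -(prednK m0) exprSr -scalerA ty scaler0.
have [c yc] : exists c, gR c *: (gR e *: y) = y.
  have : [set z | exists j c, lann y j /\ z = j + c * e] 1.
    have [_ l0 lD lM] := lann_ideal y.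
    apply: (ideal_unit noeR).
      split=> //.
      - by exists 0, 0; rewrite mul0r addr0.
      - move=> _ _ [i [c [hi ->]]] [j [d [hj ->]]]; exists (i + j), (c + d).
        by split; [exact: lD|rewrite mulrDl addrACA].
      - move=> a _ _ [i [c [hi ->]]]; exists (a * i), (a * c).
        by split; [exact: lM|rewrite mulrDr mulrA].
    apply/seteqP; split=> // q hq.
    have yq : lsupp y q by move=> r hr; apply: hq; exists r, 0; rewrite mul0r addr0.
    apply: (proj1 (We q _)); last 1 first.
    - by apply: hq; exists 0, 1; rewrite mul1r add0r.
    - move=> r /lann_cyc_one/lann_cyc_oneP[b hb]; apply: yq.
      by rewrite /lann /= hb -scalerA ym scaler0.
    - exact: yW.
  move=> [j [c [hj e1]]]; exists c.
  by rewrite scalerA -rmorphM -[RHS]scale1r -(rmorph1 gR) e1 rmorphD scalerDl hj add0r.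
pose S := GrSub (@summand_closed _ _ _ (Acyc m) W) (@summand_hcomp _ _ _ (Acyc m) W).
pose f : grhom (sval (Pwn N rep w n)) (sval M) :=
  grcomp (cyc_map ydeg ym) (grshift_hom (grsub_incl S) n).
apply: (@thick_quot _ _ _ _ (Pwn N rep w n) M f); last first.
  by apply: thick_gen; exists n.
move=> x _; have [a ->] := gen x.
have hz : S (ract ((a * gR c) *: cyc_one m) e).
  by apply/asboolP; exists ((a * gR c) *: cyc_one m).
exists (@Defs.SubType _ _ _ (Acyc m) S _ hz) => //=.
rewrite ractZ (ract_hom _ (cyc_one_deg m)) scalerA -cyc_oneE [LHS](cyc_funE ym).
by rewrite -!scalerA yc.
Qed.

Definition cyclic_pred (M : grmod) (y : M) : pred M := fun x => `[< exists a : A, x = a *: y >].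

Lemma cyclic_closed (M : grmod) (y : M) : submod_closed (cyclic_pred y).
Proof.
split=> [|c _ _ /asboolP[a ->] /asboolP[b ->]]; apply/asboolP.
  by exists 0; rewrite scale0r.
by exists (c * a + b); rewrite scalerDl scalerA.
Qed.

Lemma cyclic_hcomp (M : grmod) (y : M) i : deg M i y ->
  forall x j, cyclic_pred y x -> cyclic_pred y (hcomp x j).
Proof.
move=> hy _ j /asboolP[a ->]; have [I [f [_ hf ->]]] := gwa_span a.
rewrite scaler_suml hcomp_big; apply/asboolP.
elim: I => [|k I [b IH]]; first by exists 0; rewrite big_nil scale0r.
rewrite big_cons IH (hcomp_homog _ (grZ (hf k) hy)).
case: ifP => _; last by exists b; rewrite add0r.
by exists (f k + b); rewrite scalerDl.
Qed.

Definition cyclic (M : grmod) (y : M) i (hy : deg M i y) : grsub M :=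
  GrSub (@cyclic_closed M y) (@cyclic_hcomp M y i hy).

Lemma cyclic_gen (M : grmod) (y : M) i (hy : deg M i y) :
  exists2 y' : grsubmod (cyclic hy), sub_val y' = y &
    forall x : grsubmod (cyclic hy), exists a : A, x = a *: y'.
Proof.
have hy' : cyclic hy y by apply/asboolP; exists 1; rewrite scale1r.
exists (@Defs.SubType _ _ _ M (cyclic hy) _ hy') => // x.
have /asboolP[a xa] := sub_valP x; exists a.
by apply: val_inj; rewrite /= xa.
Qed.

(** The submodule generated by [t_- y] is covered by the induction hypothesis,
    and in the quotient the generator is killed by [t_-]. *)
Lemma cyclic_in_Ow w k (M : Oplus) i (y : sval M) :
  (forall x, exists a : A, x = a *: y) -> deg (sval M) i y -> tm ^+ k *: y = 0 ->
  lsupp y `<=` Xi s i @` rep w -> Ow N rep w M.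
Proof.
elim: k M i y => [|k IH] M i y gen hy ky yW.
  rewrite -(opprK i) in hy yW; apply: (killed_cyclic_in_Ow gen hy _ yW).
  by move: ky; rewrite scale1r => ->; rewrite scaler0.
have hty : deg (sval M) (-1 + i) (tm *: y) by apply: grZ; [exact: gdeg_tm|].
have [y' ey' gen'] := cyclic_gen hty.
pose M' := subO (cyclic hty); pose M'' := quoO (cyclic hty).
apply: (@thick_ext _ _ _ _ M' M M'' (grsub_incl (cyclic hty)) (grquo_proj (cyclic hty))).
- exact: grsub_incl_inj.
- by elim/quo_ind=> x _; exists x.
- apply/seteqP; split=> x /=.
    move=> [z _ <-]; apply/quo_piP; rewrite subr0; exact: sub_valP.
  move=> /quo_piP; rewrite subr0 => hx.
  by exists (@Defs.SubType _ _ _ (sval M) (cyclic hty) _ hx).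
- apply: (IH M' (-1 + i) y' gen').
  + by rewrite /= ey'.
  + apply: (@grsub_incl_inj _ _ _ (sval M) (cyclic hty)); rewrite linearZ linear0 /= ey'.
    by rewrite scalerA -exprSr.
  + apply: (subset_trans (lsupp_inj (@grsub_incl_inj _ _ _ (sval M) (cyclic hty)))).
    rewrite /= ey' -Xi_imageD; apply: (subset_trans (lsuppZ (gdeg_tm s v))).
    by move=> p [q hq <-]; exists q => //; exact: yW.
- have hq : deg (sval M'') (- - i) (grquo_proj (cyclic hty) y).
    by rewrite opprK; exact: gr_fun_deg.
  apply: (killed_cyclic_in_Ow _ hq).
  + elim/quo_ind=> x; have [a ->] := gen x; exists a.
    by rewrite -linearZ.
  + rewrite -linearZ; apply/quo_piP; rewrite subr0.
    by apply/asboolP; exists 1; rewrite scale1r.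
  + by rewrite opprK; apply: (subset_trans (@lsupp_linear _ _ _ _ _ (grquo_proj (cyclic hty)) _)).
Qed.

(** The module is a quotient of the direct sum of its submodules generated by a
    homogeneous element. *)
Lemma supported_in_Ow w (M : Oplus) : supported (rep w) (sval M) -> Ow N rep w M.
Proof.
move=> MW; pose I := {y : int * sval M | deg (sval M) y.1 y.2}.
pose P (i : I) : Oplus := subO (cyclic (svalP i)).
pose f (i : I) : grhom (sval (P i)) (sval M) := grsub_incl (cyclic (svalP i)).
apply: (@thick_cover _ M I P f) => [i|].
  have [y' ey' gen'] := cyclic_gen (svalP i).
  have [n /(_ n (leqnn n)) hn] := svalP M (sval i).2.
  have inj := @grsub_incl_inj _ _ _ (sval M) (cyclic (svalP i)).
  apply: (@cyclic_in_Ow w n (P i) (sval i).1 y' gen').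
  - by rewrite /= ey'; exact: (svalP i).
  - by apply: inj; rewrite linearZ linear0 /= ey'.
  - by apply: (subset_trans (lsupp_inj inj)); rewrite /= ey'; apply: MW; exact: (svalP i).
apply: surj_grhom => k y hy; pose i : I := exist _ (k, y) hy.
have [y' ey' _] := cyclic_gen (svalP i).
exists (dinj (fun i => sval (P i)) i y'); rewrite grtotal_inj.
exact: ey'.
Qed.

End Blocks.

(** * The two equivalences *)

Section Equivalences.
Variables (R : comPzRingType) (s : ring_aut R) (v : R).
Notation A := (gwa s v).
Notation gR := (@gR R s v).
Notation Z := (Zv v).
Notation grmod := (@grmod R s v).
Notation Oplus := (Oplus s v).
Implicit Types (p : spec R).

Hypothesis noeR : noetherian [set: R].
Hypothesis star : condition_star s v.
Variables (N : set (spec R) -> nat) (rep : {w | blocks s v w} -> set (spec R)).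
Hypothesis N_large : forall W, pi0 Z W ->
  forall n : nat, (N W <= n)%N -> W `&` Xi s n%:Z @` Z = set0.
Hypothesis rep_in : forall w, sval w (rep w).
Notation block := {w | blocks s v w}.

(** The set of primes on which the modules of O^+_Z are supported. *)
Let base : set (spec R) := \bigcup_w rep w.

Lemma rep_disjoint (w w' : block) p : rep w p -> rep w' p -> w = w'.
Proof.
move=> h h'; have [] := pieces_disjoint star rep_in (m := 0) (n := 0) (p := p) (w1 := w) (w2 := w').
all: by rewrite ?Xi_image0.
Qed.

Lemma rep_closed (w : block) : closed (rep w).
Proof. by apply: pi0_closed (rep_pi0 rep_in w); exact: Zv_closed. Qed.

Lemma base_closed : closed base.
Proof. exact: rep_union_closed. Qed.

Lemma base_disjoint m n p : (Xi s m @` base) p -> (Xi s n @` base) p -> m = n.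
Proof.
move=> [q [w _ wq] <-] [q' [w' _ wq'] e].
have h : (Xi s m @` rep w) (Xi s m q) by exists q.
have h' : (Xi s n @` rep w') (Xi s m q) by exists q'.
by have [_ ->] := pieces_disjoint star rep_in h h'.
Qed.

Lemma OZ_supported (M : Oplus) : OZ N rep M -> supported base (sval M).
Proof.
apply: supported_thick => P [w /(Ow_supported noeR star)].
by apply: supported_sub => p wp; exists w.
Qed.

Lemma supported_in_OZ (M : Oplus) : supported base (sval M) -> OZ N rep M.
Proof.
move=> MU; pose P w := subO (part (sval M) (rep w)).
apply: (@thick_cover _ _ _ _ M block P (fun w => grsub_incl (part (sval M) (rep w)))) => [w|].
  apply: thick_gen; exists w; apply: supported_in_Ow => //.
  exact: part_supported.
apply: (parts_total_surj noeR rep_disjoint rep_closed) => i x hx.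
have [L hL] := @finite_blocks _ s v noeR.
exists L => p /(MU _ _ hx)[q [w _ wq] <-].
by exists w; [exact: hL|exists q].
Qed.

(** The degree of an element is the index of the translate of [base] in which
    its support lies. *)
Lemma grading_by_support (M : lmodType A) : locally_nilpotent M ->
  exists g : grading M, forall i x, g i x <-> lsupp x `<=` Xi s i @` base.
Proof.
move=> Mnil; pose d i := [set x : M | lsupp x `<=` Xi s i @` base].
have d0 i : d i 0 by rewrite /d /= lsupp0.
have dB i x y : d i x -> d i y -> d i (x - y).
  move=> hx hy; apply: lsuppD => //.
  by apply: subset_trans hy; exact: lsuppN.
have dZ i j a x : gdeg i a -> d j x -> d (i + j) (a *: x).
  move=> ha hx; rewrite /d /= -Xi_imageD.
  apply: (subset_trans (lsuppZ ha)) => p [q hq <-].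
  by exists q => //; exact: hx.
have cl i : closed (Xi s i @` base) by apply: Xi_image_closed; exact: base_closed.
have dspan x : exists (I : seq int) (f : int -> M),
    [/\ uniq I, forall i, d i (f i) & x = \sum_(i <- I) f i].
  have [n /(_ n (leqnn n)) xn] := Mnil x.
  have [L hL] := translates_finite_pieces noeR rep_in n.
  pose J := undup [seq wn.2 | wn <- L].
  have [|e [xe he]] := lsupp_decomposition noeR base_disjoint cl (x := x) (undup_uniq [seq wn.2 | wn <- L]).
    move=> p xp; have [wn wnL [q hq <-]] := hL p (lsupp_nilpotent xn xp).
    exists wn.2; first by rewrite mem_undup; exact: map_f.
    by exists q => //; exists wn.1.
  exists J, (fun i => if i \in J then gR (e i) *: x else 0); split.
  - exact: undup_uniq.
  - by move=> i; case: ifP => // iJ; exact: (he i iJ).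
  - by rewrite {1}xe; apply: eq_big_seq => i ->.
have dfree (I : seq int) (f : int -> M) : uniq I -> (forall i, d i (f i)) ->
    \sum_(i <- I) f i = 0 -> forall i, i \in I -> f i = 0.
  move=> uI hf sf; apply: (lsupp_independent noeR base_disjoint uI _ sf).
  by move=> i _; exact: hf.
by exists (Grading d0 dB dZ dspan dfree).
Qed.

(** A linear map cannot enlarge supports, and in a module supported on [base]
    the support determines the degree. *)
Lemma linear_graded (M M' : grmod) (f : {linear M -> M'}) :
  supported base M -> supported base M' -> forall i x, deg M i x -> deg M' i (f x).
Proof.
move=> MU MU' i x hx; set y := f x.
have yU : lsupp y `<=` Xi s i @` base.
  by apply: (subset_trans (@lsupp_linear _ _ _ _ _ f _)); exact: MU.
pose L := undup (i :: hsupp y); have uL : uniq L by exact: undup_uniq.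
have iL : i \in L by rewrite mem_undup inE eqxx.
have hL : {subset hsupp y <= L} by move=> j jy; rewrite mem_undup inE jy orbT.
pose g j := hcomp y j - (if j == i then y else 0).
have g0 : \sum_(j <- L) g j = 0.
  rewrite sumrB -(hcomp_sum uL hL) -big_mkcond -big_filter.
  by rewrite filter_pred1_uniq // big_seq1 subrr.
have gU j : j \in L -> lsupp (g j) `<=` Xi s j @` base.
  move=> _; apply: lsuppD; first by apply: MU'; exact: hcomp_deg.
  case: eqP => [->|_]; last by rewrite oppr0 lsupp0.
  by apply: subset_trans yU; exact: lsuppN.
have /eqP := lsupp_independent noeR base_disjoint uL gU g0 iL.
by rewrite /g eqxx subr_eq0 => /eqP <-; exact: hcomp_deg.
Qed.

Lemma forget_equivalence : is_equivalence (forget (OZ N rep)).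
Proof.
apply: equivalence_of_fully_faithful.
- move=> M M' f g fg; apply: grhom_ext => x.
  exact: (congr1 (fun h : {linear _ -> _} => h x) fg).
- move=> [[M Mnil] MZ] [[M' Mnil'] MZ'] g; rewrite /= in g *.
  exists (GrHom (linear_graded g (OZ_supported MZ) (OZ_supported MZ'))).
  by [].
- move=> [M Mnil]; have [g hg] := grading_by_support Mnil.
  pose M' : Oplus := exist _ (GrMod g) Mnil.
  have MZ : OZ N rep M' by apply: supported_in_OZ => i x /hg.
  exists (exist _ M' MZ); exists (idfun : {linear M -> M}).
  by exists (idfun : {linear M -> M}); split; apply: linear_ext.
Qed.

Let piece (wn : block * int) : set (spec R) := Xi s wn.2 @` rep wn.1.

Lemma piece_disjoint a b p : piece a p -> piece b p -> a = b.
Proof.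
case: a b => [w m] [w' n] h h'.
by have [/= -> ->] := pieces_disjoint star rep_in h h'.
Qed.

Lemma piece_closed a : closed (piece a).
Proof. by apply: Xi_image_closed; exact: rep_closed. Qed.

Lemma Ow_shift_supported a (M : Oplus) : Ow_shift N rep a M -> supported (piece a) (sval M).
Proof.
move=> [M0 /(Ow_supported noeR star) h ->].
exact: (@supported_shift _ _ _ _ _ a.2 h).
Qed.

Lemma grhom_eq0 (M M' : grmod) (C1 C2 : set (spec R)) (f : grhom M M') :
  supported C1 M -> supported C2 M' -> C1 `&` C2 = set0 -> forall x, f x = 0.
Proof.
move=> h1 h2 C12 x; apply: hcomp_eq0 => i; rewrite hcomp_grhom.
apply: (lsupp_eq0 noeR); apply/seteqP; split=> // p hp.
suff : (C1 `&` C2) (Xi s (- i) p) by rewrite C12.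
split; apply/XiE.
  by apply: h1 (hcomp_deg x i) _ _; exact: (lsupp_linear hp).
by apply: h2 hp; apply: gr_fun_deg; exact: hcomp_deg.
Qed.

(** [shiftO] back and forth changes the grading only up to the equality
    [i + n - n = i], which is propositional; [grunshift] and [grreshift] are the
    resulting isomorphisms. *)
Definition grunshift (M : grmod) (n : int) : grhom (grshift (grshift M (- n)) n) M.
Proof.
refine (@GrHom _ _ _ (grshift (grshift M (- n)) n) M (idfun : {linear M -> M}) _).
by move=> i x; rewrite /= addrK.
Defined.

Definition grreshift (M : grmod) (n : int) : grhom M (grshift (grshift M (- n)) n).
Proof.
refine (@GrHom _ _ _ M (grshift (grshift M (- n)) n) (idfun : {linear M -> M}) _).
by move=> i x; rewrite /= addrK.
Defined.

(** Belonging to [Ow_shift] requires an object which is literally a shift, so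
    the part on [piece a] is shifted by [- a.2] and back. *)
Lemma part_in_Ow_shift (M : Oplus) (a : block * int) :
  Ow_shift N rep a (shiftO (shiftO (subO (part (sval M) (piece a))) (- a.2)) a.2).
Proof.
exists (shiftO (subO (part (sval M) (piece a))) (- a.2)) => //.
apply: supported_in_Ow => //.
have -> : rep a.1 = Xi s (- a.2) @` piece a by rewrite /piece Xi_imageD addNr Xi_image0.
by apply: supported_shift; exact: part_supported.
Qed.

Lemma Oplus_cover (M : Oplus) i (x : sval M) : deg (sval M) i x ->
  exists L : seq {classic (block * int)},
    lsupp x `<=` [set p | exists2 a, a \in L & (Xi s i @` piece a) p].
Proof.
move=> hx; have [n /(_ n (leqnn n)) xn] := svalP M x.
have [L hL] := translates_finite_pieces noeR rep_in n.
exists [seq ((wn.1, wn.2 - i) : {classic (block * int)}) | wn <- L] => p xp.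
have [wn wnL hp] := hL p (lsupp_nilpotent xn xp).
exists ((wn.1, wn.2 - i) : {classic (block * int)}).
  exact: (map_f (fun wn : {classic block} * int => (wn.1, wn.2 - i) : {classic (block * int)})).
by rewrite /piece Xi_imageD /= addrC subrK.
Qed.

Lemma realize_equivalence : is_equivalence (realize (Ow_shift N rep)).
Proof.
apply: equivalence_of_fully_faithful.
- move=> a b f g fg; apply: functional_extensionality_dep => j.
  apply: grhom_ext => x.
  pose Q i := sval (sval (a i)).
  have := congr1 (fun h : grhom _ _ => h (dinj Q j x)) fg.
  move=> /(congr1 (fun h : dsum _ => h j)) /=.
  by rewrite !inj_fun_eq.
- move=> a b g.
  pose P i := sval (sval (a i)); pose Q i := sval (sval (b i)).
  pose g' : grhom (grdsum P) (grdsum Q) := g.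
  exists (fun j => grcomp (dproj Q j) (grcomp g' (dinj P j))).
  apply: grhom_ext => x; apply: dsum_ext => k.
  change (dproj Q k (g' (dinj P k (x k))) = dproj Q k (g' x)).
  rewrite -{2}(grtotal_dinj_id x) /= /dsum_total !linear_sum.
  (* The components of [g] between summands with different indices vanish, as
     their supports are disjoint. *)
  have zero j (y : P j) : j <> k -> dproj Q k (g' (dinj P j y)) = 0.
    move=> jk; apply: (@grhom_eq0 (P j) (Q k) (piece j) (piece k)
      (grcomp (dproj Q k) (grcomp g' (dinj P j)))).
    + exact: Ow_shift_supported (svalP (a j)).
    + exact: Ow_shift_supported (svalP (b k)).
    + by apply/seteqP; split=> // p [h h']; apply: jk; exact: piece_disjoint h h'.
  have [kx|kx] := boolP ((k : {classic block * int}) \in dsupp x).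
    rewrite (bigD1_seq (k : {classic block * int})) ?dsupp_uniq //= big1 ?addr0 //.
    by move=> j /eqP jk; exact: zero.
  rewrite (dsupp_notin kx) !linear0 big_seq big1 // => j jx; apply: zero => jk.
  by rewrite -jk jx in kx.
- move=> M; pose P a := subO (part (sval M) (piece a)).
  pose Q a := shiftO (shiftO (P a) (- a.2)) a.2.
  exists (fun a => exist _ (Q a) (part_in_Ow_shift M a)).
  pose u a : grhom (sval (Q a)) (sval (P a)) := grunshift (sval (P a)) a.2.
  pose w a : grhom (sval (P a)) (sval (Q a)) := grreshift (sval (P a)) a.2.
  pose f : grhom (sval (dsumO Q)) (sval M) :=
    grcomp (parts_total piece (sval M)) (grdsum_map u).
  have finj : injective f.
    move=> x y /(parts_total_inj noeR piece_disjoint) xy; apply: dsum_ext => a.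
    exact: (congr1 (fun h : dsum (fun a => sval (P a)) => h a) xy).
  have fsurj y : exists x, f x = y.
    have [z <-] := parts_total_surj noeR piece_disjoint piece_closed (@Oplus_cover M) y.
    exists (grdsum_map w z).
    have e : grdsum_map u (grdsum_map w z) = z by exact: dsum_ext.
    exact: (congr1 (parts_total piece (sval M)) e).
  exact: (Oplus_iso finj fsurj).
Qed.

End Equivalences.

Theorem theorem3p8 (K : realType) (R : comPzRingType)
  (iota : {rmorphism K[i] -> R}) (sigma : ring_aut R) (v : R)
  (R_fg : fin_gen iota)
  (sigma_alg : forall c : K[i], sigma (iota c) = iota c)
  (star : condition_star sigma v)
  (N : set (spec R) -> nat)
  (N_large : forall W, pi0 (Zv v) W ->
     forall n : nat, (N W <= n)%N -> W `&` Xi sigma n%:Z @` Zv v = set0)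
  (rep : {w | blocks sigma v w} -> set (spec R))
  (rep_in : forall w, sval w (rep w)) :
  is_equivalence (forget (OZ N rep)) /\
  is_equivalence (realize (Ow_shift N rep)).
Proof.
have noeR := fin_gen_noetherian R_fg.
split; first exact: forget_equivalence.
exact: realize_equivalence.
Qed.
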